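(* Assume that there are positive constants $K,\gamma_0$ such that $$|d\,h'(cd)|\le K[h(d)+1]\qquad\text{for all } d>0 \text{ and all } c \text{ with } |c-1|\le\gamma_0.$$ For $\lambda>0$ let $r$ be any minimizer of $\hat I$ over $\mathcal{A}_\lambda$. Then: 1. If $\lambda<\bar\lambda$, then $r(R)=\lambda R$ for $R\in[0,1]$, where $\bar\lambda$ is the (unique) solution of $\hat T(\bar\lambda,\bar\lambda)=0$. 2. If $\lambda$ is sufficiently large, then $r(0)>0$; that is, there is $\Lambda>0$ such that for every $\lambda>\Lambda$ every minimizer $r$ of $\hat I$ over $\mathcal{A}_\lambda$ satisfies $r(0)>0$.
   Context: $n\in\{2,3\}$ and $\kappa>0$. The function $h:(0,\infty)\to[0,\infty)$ is $C^1$ (with second derivative existing) and satisfies: $h''(d)>0$ for all $d>0$; $\lim_{d\to0^+}h(d)=\infty$; $\lim_{d\to\infty}h(d)/d=\infty$; $\lim_{d\to0^+}h'(d)=-\infty$; $\lim_{d\to\infty}h'(d)=\infty$. Admissible set: $\mathcal{A}_\lambda=\{r\in W^{1,1}(0,1): r(1)=\lambda,\ r'(R)>0\text{ for a.e. }R\in(0,1),\ r(0)\ge0\}$. Modified functional: $$\hat I(r)=\int_0^1R^{n-1}\left[\frac{\kappa}{n}(r'(R))^n+h(\delta(R))+\kappa(n-1)\delta(R)\left(\frac1n+\ln\left(\frac{r(R)}{R}\right)\right)\right]dR-\frac{\kappa(n-1)}{n}\lambda^n\ln\lambda,$$ with $\delta(R)=r'(R)\left(\frac{r(R)}{R}\right)^{n-1}$.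 For $\nu,v>0$, $$\hat T(\nu,v)=\kappa\left(\frac{\nu}{v}\right)^{n-1}+h'(\nu v^{n-1})+(n-1)\kappa\left(\frac1n+\ln v\right).$$ The function $v\mapsto\hat T(v,v)$ is strictly increasing from $-\infty$ to $\infty$ on $(0,\infty)$, so $\bar\lambda$ exists and is unique. *)

(* Defs.v *)
From mathcomp Require Import all_boot all_order all_algebra.
From mathcomp Require Import all_classical all_reals all_analysis.

Set Implicit Arguments.
Unset Strict Implicit.
Unset Printing Implicit Defensive.

Import Order.TTheory GRing.Theory Num.Theory.
Import numFieldNormedType.Exports.

Local Open Scope ring_scope.
Local Open Scope classical_set_scope.

Section Sobolev.
Context {R : realType}.
Notation mu := (@lebesgue_measure R).

Definition C1c (phi : R -> R) : Prop :=
  [/\ forall x : R, derivable phi x 1,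
      continuous phi^`()%classic,
      compact (closure [set x | phi x != 0]) &
      closure [set x | phi x != 0] `<=` `]0, 1[ ].

Definition is_weak_deriv (r g : R -> R) : Prop :=
  mu.-integrable `]0, 1[ (EFin \o g) /\
  forall phi : R -> R, C1c phi ->
    \int[mu]_(x in `]0, 1[) (r x * phi^`()%classic x) =
    - \int[mu]_(x in `]0, 1[) (g x * phi x).

(* An element of W^{1,1}(0,1) is given by its representative that is continuous
   on [0,1], so that the boundary values r 0 and r 1 make sense; the values of r
   outside [0,1] are irrelevant. *)
Definition W11 (r : R -> R) : Prop :=
  [/\ {within `[0, 1], continuous r},
      mu.-integrable `]0, 1[ (EFin \o r) &
      exists g, is_weak_deriv r g].

(* A chosen version of the weak derivative, which is unique up to a null set of
   (0,1); it is the junk value 0 if there is none. *)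
Definition weak_deriv (r : R -> R) : R -> R :=
  xget (fun=> 0) [set g | is_weak_deriv r g].

End Sobolev.

Section Energy.
Context {R : realType}.
Variables (n : nat) (kappa : R) (h : R -> R).
Notation mu := (@lebesgue_measure R).

Definition admissible (lambda : R) : set (R -> R) :=
  [set r | [/\ W11 r, r 1 = lambda,
               {ae mu, forall x : R, 0 < x < 1 -> 0 < weak_deriv r x} &
               0 <= r 0]].

Definition delta (r : R -> R) (x : R) : R :=
  weak_deriv r x * (r x / x) ^+ n.-1.

Definition Ihat_density (r : R -> R) (x : R) : R :=
  x ^+ n.-1 *
  (kappa / n%:R * weak_deriv r x ^+ n + h (delta r x) +
   kappa * (n%:R - 1) * delta r x * (n%:R^-1 + ln (r x / x))).

(* Extended-real valued: on admissible functions the negative part of the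
   density is integrable, but the integral may be +oo. *)
Definition Ihat (lambda : R) (r : R -> R) : \bar R :=
  (\int[mu]_(x in `]0%R, 1%R[) (Ihat_density r x)%:E
   - (kappa * (n%:R - 1) / n%:R * lambda ^+ n * ln lambda)%:E)%E.

Definition Ihat_minimizer (lambda : R) (r : R -> R) : Prop :=
  admissible lambda r /\
  forall s, admissible lambda s -> (Ihat lambda r <= Ihat lambda s)%E.

Definition That (nu v : R) : R :=
  kappa * (nu / v) ^+ n.-1 + h^`()%classic (nu * v ^+ n.-1) +
  (n%:R - 1) * kappa * (n%:R^-1 + ln v).

End Energy.

(* Main.v *)
Require Import Defs.
From mathcomp Require Import all_boot all_order all_algebra.
From mathcomp Require Import all_classical all_reals all_analysis.
From mathcomp Require Import measurable_realfun ring lra.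
Import Order.TTheory GRing.Theory Num.Theory.
Import numFieldNormedType.Exports.
Local Open Scope ring_scope.
Local Open Scope classical_set_scope.

(* At fixed determinant [d = nu * v ^ (n-1)], the bound [1 + u <= exp u] shows
   that the stored energy is minimal at [nu = v], with minimum a strictly convex
   function [H d] such that [H' (v ^ n) = That v v]. The integral of
   [x ^ (n-1) * delta] is [(lambda ^ n - r 0 ^ n) / n], so integrating the tangent
   line of [H] at [L = lambda ^ n] bounds the energy of [r] from below by
   [(H L - H' L * r 0 ^ n) / n], while [x |-> lambda * x] has energy [H L / n].
   - If [lambda < lambdabar] then [H' L < 0], hence a minimizer has [r 0 = 0] and
     attains the tangent line almost everywhere: [delta = L], so
     [r x ^ n = L * x ^ n].
   - A deformation with [r 0 = 0] has energy at least [H L / n], which grows faster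
     than the energy of the cavitating map [x |-> (x ^ n + L - 1) ^ (1/n)]. *)

Set Implicit Arguments.
Unset Strict Implicit.

(** Throughout, [m] stands for [n - 1]. The determinant term is a null Lagrangian: [x ^+ m * delta]
    is [r ^+ m] times the derivative of [r]. A tangent line is affine in the determinant, so it
    integrates to boundary data, and a cavity enters the bound only through [r 0 ^+ m.+1], with the
    sign of [- H' L]. The main obstacle is regularity. An admissible [r] is only in W11, and
    [weak_deriv r] is an arbitrary choice among almost everywhere equal functions. It is therefore
    replaced by an everywhere positive integrable version [gam], of which [r] is shown to be a
    primitive. The chain rule for [r ^+ m.+1] is then read off from the monotonicity of [r], through
    a quadratic bound on increments. A second obstacle is that the energy may be infinite.
    Comparison with an explicit competitor bounds it from above and the tangent line is an
    integrable minorant; together they make the density integrable. The cavitating map has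
    determinant 1, so that [h] contributes only the constant [h 1] to its energy, and the factor
    [x ^+ m] tames the logarithm at the origin. *)

Section IntegralAe.
Context {d : measure_display} {T : measurableType d} {R : realType}.
Variable mu : {measure set T -> \bar R}.
Import HBNNSimple.

(** The integral of a nonnegative function is a supremum over the simple functions below it. Cutting
    such a simple function to zero on the exceptional null set keeps its integral and puts it below
    [g]. *)
Lemma ge0_ae_le_integral (D : set T) (f g : T -> \bar R) :
  (forall x, 0 <= f x)%E -> (forall x, 0 <= g x)%E ->
  {ae mu, forall x, D x -> f x = g x} ->
  (\int[mu]_(x in D) f x <= \int[mu]_(x in D) g x)%E.
Proof.
move=> f0 g0 [N [mN N0 fgN]].
rewrite ge0_integralE// ge0_integralE//.
apply: ge_ereal_sup => /= _ [u /= uf <-].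
have mNc : measurable (~` N) by exact: measurableC.
pose u' := mul_nnsfun u (indic_nnsfun R mNc).
have -> : sintegral mu u = sintegral mu u'.
  have sE (v : {nnsfun T >-> R}) : sintegral mu v = (\int[mu]_x (v x)%:E)%E.
    by rewrite integral_nnsfun// patch_setT.
  rewrite !sE; apply: ge0_ae_eq_integral => //.
  - exact/measurable_EFinP.
  - exact/measurable_EFinP.
  - by move=> x _; rewrite lee_fin.
  - by move=> x _; rewrite lee_fin.
  exists N; split => // x /= /not_implyP[_ ne]; apply: contrapT => Nx; apply: ne.
  by rewrite /u' /= mindicE mem_set// mulr1.
apply: ereal_sup_ubound; exists u' => // x.
have := uf x; rewrite /u' /= mindicE !patchE.
have [Nx|Nx] := pselect (N x).
  rewrite (_ : (x \in ~` N) = false) ?mulr0; first by case: ifP.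
  by apply/negbTE; rewrite notin_setE; apply.
rewrite [x \in ~` N]mem_set// mulr1.
case: ifP => // /set_mem Dx.
have -> // : f x = g x.
by apply: contrapT => ne; apply: Nx; apply: fgN => /= /(_ Dx).
Qed.

(* Unlike [ae_eq_integral], this needs no measurability: [h] is arbitrary on
   the nonpositive reals, so the energy density is only known to agree almost
   everywhere with a Borel function. *)
Lemma eq_integral_ae (D : set T) (f g : T -> \bar R) :
  {ae mu, forall x, D x -> f x = g x} ->
  (\int[mu]_(x in D) f x = \int[mu]_(x in D) g x)%E.
Proof.
move=> fg; rewrite integralE [RHS]integralE.
by congr (_ - _)%E; apply/eqP; rewrite eq_le; apply/andP; split;
  apply: ge0_ae_le_integral => //; apply: filterS fg => x /[apply];
  rewrite ?funeposE ?funenegE => ->.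
Qed.
End IntegralAe.

(** * Mollification by a piecewise linear kernel *)

Section Smoothstep.
Context {R : realType}.

(** Test functions in [C1c] need only one continuous derivative, so quadratic splines suffice; this
    truncated square is their building block. *)
Definition sqpos (t : R) : R := Num.max t 0 ^+ 2.

Lemma is_derive_sqpos (t : R) : is_derive t 1 sqpos (2 * Num.max t 0).
Proof.
have E : h^-1 *: ((sqpos \o shift t) (h *: 1) - sqpos t) @[h --> (0:R)^'] -->
    2 * Num.max t 0.
  apply/cvgrPdist_le => e e0; near=> h.
  have h0 : h != 0 by near: h; exact: nbhs_dnbhs_neq.
  have he : `|h| <= e by near: h; apply: dnbhs0_le.
  apply: (le_trans _ he); rewrite /= /sqpos [h *: 1]mulr1.
  set q := _ ^+ 2 - _ ^+ 2.
  rewrite [h^-1 *: q]/(h^-1 * q).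
  have -> : 2 * Num.max t 0 - h^-1 * q = h^-1 * (2 * Num.max t 0 * h - q).
    by field.
  rewrite normrM normfV -ler_pdivlMl ?invr_gt0 ?normr_gt0// invrK.
  have -> : `|h| * `|h| = h ^+ 2 by rewrite -normrM -expr2 ger0_norm// sqr_ge0.
  rewrite ler_norml /q.
  by case: (ltP t 0) => ht; case: (ltP (h + t) 0) => hht;
     apply/andP; split; nra.
apply: DeriveDef; first by apply/cvg_ex; exists (2 * Num.max t 0).
by apply/cvg_lim.
Unshelve. all: by end_near. Qed.

(** The quadratic spline with knots 0, 1/2 and 1 that rises from 0 to 1; its derivative [tent] is
    the hat function of height 2 and mass 1 on [[0, 1]]. *)
Definition smoothstep (t : R) : R :=
  2 * (sqpos t - 2 * sqpos (t - 2^-1) + sqpos (t - 1)).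

Definition tent (t : R) : R :=
  4 * (Num.max t 0 - 2 * Num.max (t - 2^-1) 0 + Num.max (t - 1) 0).

Lemma is_derive_smoothstep (t : R) : is_derive t 1 smoothstep (tent t).
Proof.
have S c : is_derive t 1 (fun s => sqpos (s - c)) (2 * Num.max (t - c) 0).
  have -> : (fun s => sqpos (s - c)) = sqpos \o (fun s => s - c) by [].
  have -> : 2 * Num.max (t - c) 0 = (2 * Num.max (t - c) 0) * (1 - 0) by ring.
  by apply: is_derive1_comp; exact: is_derive_sqpos.
have -> : smoothstep = 2 \*: (sqpos - (2 \*: (fun s => sqpos (s - 2^-1))) +
    (fun s => sqpos (s - 1))).
  by apply/funext => s.
have D0 := is_derive_sqpos t; have D1 := S 2^-1; have D2 := S 1.
apply: is_derive_eq.
rewrite /tent /GRing.scale /=; lra.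
Qed.

Lemma tent_ge0 t : 0 <= tent t.
Proof.
rewrite /tent.
by case: (ltP t 0) => ?; case: (ltP (t - 2^-1) 0) => ?;
  case: (ltP (t - 1) 0) => ?; lra.
Qed.

Lemma tent_out t : t <= 0 \/ 1 <= t -> tent t = 0.
Proof.
rewrite /tent.
by case: (ltP t 0) => ?; case: (ltP (t - 2^-1) 0) => ?;
  case: (ltP (t - 1) 0) => ? [] ?; lra.
Qed.

Lemma continuous_tent : continuous tent.
Proof.
move=> t; rewrite /tent; apply: cvgM; first exact: cvg_cst.
have M c : (Num.max (s - c) 0) @[s --> t] --> Num.max (t - c) 0.
  have maxE u : Num.max u 0 = 2^-1 * (u + `|u|) :> R.
    by case: (ltP u 0) => u0; [rewrite ltr0_norm//|rewrite ger0_norm//]; lra.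
  under eq_fun do rewrite maxE.
  rewrite maxE; apply: cvgM; first exact: cvg_cst.
  have C : (s - c) @[s --> t] --> t - c.
    by apply: cvgB; [exact: cvg_id|exact: cvg_cst].
  by apply: cvgD => //; exact: cvg_norm.
apply: cvgD => //; apply: cvgB.
  by have := M 0; rewrite subr0; under eq_fun do rewrite subr0.
by apply: cvgM => //; exact: cvg_cst.
Qed.

Lemma smoothstep_le0 t : t <= 0 -> smoothstep t = 0.
Proof.
rewrite /smoothstep /sqpos => ?.
by rewrite (@max_r _ _ t)// !max_r; lra.
Qed.

Lemma smoothstep_ge1 t : 1 <= t -> smoothstep t = 1.
Proof.
rewrite /smoothstep /sqpos => ?.
by rewrite (@max_l _ _ t)// ?max_l; lra.
Qed.

Lemma smoothstep_bound t : 0 <= smoothstep t <= 1.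
Proof.
rewrite /smoothstep /sqpos.
by case: (ltP t 0) => ?; case: (ltP (t - 2^-1) 0) => ?;
  case: (ltP (t - 1) 0) => ?; nra.
Qed.

End Smoothstep.

Section RealIntegrable.
Context d (T : measurableType d) (R : realType) (mu : {measure set T -> \bar R}).

Lemma integrable_addr (D : set T) (f g : T -> R) : measurable D ->
  mu.-integrable D (EFin \o f) -> mu.-integrable D (EFin \o g) ->
  mu.-integrable D (EFin \o (fun x => f x + g x)).
Proof. by move=> mD fi gi;exact: (integrableD mD fi gi). Qed.

Lemma integrable_subr (D : set T) (f g : T -> R) : measurable D ->
  mu.-integrable D (EFin \o f) -> mu.-integrable D (EFin \o g) ->
  mu.-integrable D (EFin \o (fun x => f x - g x)).
Proof. by move=> mD fi gi;exact: (integrableB mD fi gi). Qed.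

Lemma integrable_mulrl (D : set T) (k : R) (f : T -> R) : measurable D ->
  mu.-integrable D (EFin \o f) ->
  mu.-integrable D (EFin \o (fun x => k * f x)).
Proof. by move=> mD fi;exact: (integrableZl mD k fi). Qed.

End RealIntegrable.

Section Mollify.
Context {R : realType}.
Notation mu := (@lebesgue_measure R).

Lemma is_derive_scaled_step (w a x : R) :
  is_derive x 1 (fun y => smoothstep (w * (y - a))) (w * tent (w * (x - a))).
Proof.
have -> : (fun y => smoothstep (w * (y - a))) =
    smoothstep \o (fun y => w * (y - a)) by [].
have D := is_derive_smoothstep (w * (x - a)).
have -> : w * tent (w * (x - a)) = tent (w * (x - a)) * (w * (1 - 0)) by ring.
apply: is_derive1_comp.
Qed.

Lemma continuous_scaled_tent (w a : R) :
  continuous (fun y => w * tent (w * (y - a)) : R).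
Proof.
move=> x; apply: cvgM; first exact: cvg_cst.
apply: (@continuous_comp _ _ _ (fun y => w * (y - a)) tent); last first.
  exact: continuous_tent.
by apply: cvgM; [exact: cvg_cst|apply: cvgB; [exact: cvg_id|exact: cvg_cst]].
Qed.

Lemma is_derive_derive1 (f : R -> R) (x l : R) :
  is_derive x 1 f l -> f^`()%classic x = l.
Proof. by move=> H; rewrite derive1E; apply: derive_val. Qed.

Lemma is_derive_continuous (f : R -> R) (x l : R) :
  is_derive x 1 f l -> {for x, continuous f}.
Proof.
move=> H; apply: differentiable_continuous.
by apply/derivable1_diffP; exact: ex_derive.
Qed.

Lemma is_derive_LRcontinuous (f df : R -> R) (a b : R) :
  (forall x : R, is_derive x 1 f (df x)) -> derivable_oo_LRcontinuous f a b.
Proof.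
move=> fD; split => [x _||].
- exact: ex_derive.
- exact/cvg_at_right_filter/is_derive_continuous.
- exact/cvg_at_left_filter/is_derive_continuous.
Qed.

Lemma continuous_integrable01 (f : R -> R) :
  {within `[0, 1], continuous f} -> mu.-integrable `[0, 1] (EFin \o f).
Proof.
move=> cf; apply: continuous_compact_integrable => //; exact: segment_compact.
Qed.

(** The antiderivative rises from 0 to 1. The condition on [w * (1 - a)] says that the support
    [[a, a + w^-1]] of the kernel does not leave [[0, 1]]. *)
Lemma integral_scaled_tent (w a : R) : 0 < a -> w * (1 - a) >= 1 -> 0 < w ->
  \int[mu]_(x in `[0, 1]) (w * tent (w * (x - a))) = 1.
Proof.
move=> a0 wa w0; rewrite /Rintegral (@continuous_FTC2 _ _
  (fun y => smoothstep (w * (y - a))))//=.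
- rewrite smoothstep_ge1// smoothstep_le0 ?subr0//.
  by rewrite pmulr_rle0//; lra.
- exact/continuous_subspaceT/continuous_scaled_tent.
- apply: (@is_derive_LRcontinuous _ (fun y => w * tent (w * (y - a)))) => x.
  exact: is_derive_scaled_step.
- by move=> x _; exact/is_derive_derive1/is_derive_scaled_step.
Qed.

Lemma within01_continuous_at (r : R -> R) (a : R) : 0 < a < 1 ->
  {within `[0, 1], continuous r} -> {for a, continuous r}.
Proof.
move=> a01 /within_continuous_continuous; apply => //.
Qed.

(** The kernels form a one-sided approximate identity at [a]: mass one, carried by
    [[a, a + k^-1]]. *)
Lemma cvg_mollify (r : R -> R) (a : R) : 0 < a < 1 ->
  {within `[0, 1], continuous r} ->
  \int[mu]_(x in `[0, 1]) (r x * (k%:R * tent (k%:R * (x - a))))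
    @[k --> \oo] --> r a.
Proof.
move=> a01 cr; apply/cvgrPdist_le => e e0.
have /cvgrPdist_le /(_ _ e0) [d /= d0 dr] :=
  within01_continuous_at a01 cr.
(* The first term keeps the kernel inside [[0, 1]]; the second keeps its support within distance [d]
   of [a], where [r] varies by at most [e]. *)
have M : \forall k \near \oo, (1 - a)^-1 + d^-1 + 1 <= k%:R :> R.
  exact: nbhs_infty_ger.
near=> k.
have hk : (1 - a)^-1 + d^-1 + 1 <= k%:R :> R by near: k.
have d'0 : 0 < d^-1 by rewrite invr_gt0.
have a'0 : 0 < (1 - a)^-1 by rewrite invr_gt0; lra.
have k0 : 0 < k%:R :> R by lra.
have ka : k%:R * (1 - a) >= 1.
  by rewrite -ler_pdivrMr; [rewrite mul1r; lra|lra].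
have kd : k%:R * d > 1.
  by rewrite -ltr_pdivrMr// mul1r; lra.
have T := integral_scaled_tent (proj1 (andP a01)) ka k0.
have cT : continuous (fun y => k%:R * tent (k%:R * (y - a)) : R).
  exact: continuous_scaled_tent.
have cTw : {within `[0, 1],
    continuous (fun y => k%:R * tent (k%:R * (y - a)) : R)}.
  exact: continuous_subspaceT.
have i1 : mu.-integrable `[0, 1]
    (EFin \o (fun x => r x * (k%:R * tent (k%:R * (x - a))))).
  apply: continuous_integrable01 => x.
  by apply: cvgM; [exact: cr|exact: cTw].
have i2 : mu.-integrable `[0, 1]
    (EFin \o (fun x => r a * (k%:R * tent (k%:R * (x - a))))).
  apply: continuous_integrable01 => x.
  by apply: cvgM; [exact: cvg_cst|exact: cTw].
have i3 : mu.-integrable `[0, 1]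
    (EFin \o (fun x => e * (k%:R * tent (k%:R * (x - a))))).
  apply: continuous_integrable01 => x.
  by apply: cvgM; [exact: cvg_cst|exact: cTw].
have i0 : mu.-integrable `[0, 1]
    (EFin \o (fun x => k%:R * tent (k%:R * (x - a)))).
  by exact: continuous_integrable01.
(* Both [r a] and [e] are written as integrals against the kernel of mass one, which leaves a
   pointwise comparison. *)
rewrite -[r a]mulr1 -[X in _ * X]T -RintegralZl// -RintegralB//.
rewrite -[leRHS]mulr1 -[X in _ * X]T -RintegralZl//.
apply: le_trans (le_normr_Rintegral _ _) _ => //.
  exact: integrable_subr.
apply: le_Rintegral => //.
  exact/integrable_norm/integrable_subr.
move=> x _; rewrite -mulrBl normrM.
have t0 := tent_ge0 (k%:R * (x - a)).
have w0 := mulr_ge0 (ltW k0) t0.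
rewrite [X in _ * X <= _](ger0_norm w0).
have [xa|xa] := leP (k%:R * (x - a)) 0.
  by rewrite tent_out ?mulr0//; left.
have [xb|xb] := leP 1 (k%:R * (x - a)).
  by rewrite tent_out ?mulr0//; right.
apply: ler_wpM2r; first exact: w0.
apply: dr => /=; rewrite distrC.
rewrite pmulr_rgt0// in xa.
by rewrite gtr0_norm// -(@ltr_pM2l _ k%:R)//; lra.
Unshelve. by end_near. Qed.

End Mollify.

(** * Weak derivatives of continuous representatives *)

Section FundamentalTheorem.
Context {R : realType}.
Notation mu := (@lebesgue_measure R).

(* The cast selects the sigma-algebra carried by [lebesgue_measure], which is
   not the one inferred from [R]. *)
Lemma measurable_itvR (i : interval R) :
  measurable ([set` i] : set (measurableTypeR R)).
Proof. exact: measurable_itv. Qed.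

Lemma integrable_sub01 (f : R -> R) (i : interval R) :
  [set` i] `<=` `[0, 1] -> mu.-integrable `[0, 1] (EFin \o f) ->
  mu.-integrable [set` i] (EFin \o f).
Proof. by move=> i01; apply: integrableS. Qed.

Lemma Rintegral_itv_oo_cc (f : R -> R) : mu.-integrable `[0, 1] (EFin \o f) ->
  \int[mu]_(x in `]0, 1[) f x = \int[mu]_(x in `[0, 1]) f x.
Proof.
move=> fi; rewrite Rintegral_itv_bndo_bndc.
  rewrite Rintegral_itv_obnd_cbnd//.
  by apply: integrable_sub01 fi; exact: subset_itv_oc_cc.
by apply: integrable_sub01 fi; exact: subset_itv_oo_cc.
Qed.

Lemma primitiveB (f : R -> R) (x y : R) : 0 <= x -> x <= y -> y <= 1 ->
  mu.-integrable `[0, 1] (EFin \o f) ->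
  \int[mu]_(t in `[0, y]) f t - \int[mu]_(t in `[0, x]) f t =
  \int[mu]_(t in `[x, y]) f t.
Proof.
move=> x0 xy y1 fi; rewrite -Rintegral_itv_obnd_cbnd.
  apply: Rintegral_itvB; rewrite ?bnd_simp//.
  by apply: integrable_sub01 fi; apply: subset_itvl; rewrite bnd_simp.
apply: integrable_sub01 fi => t /=; rewrite !in_itv/= => /andP[? ?].
by apply/andP; split; lra.
Qed.

(** A smoothed indicator of []a, b]]: its derivative is the difference of the kernels at [a] and
    [b], so testing with it isolates [r a - r b]. *)
Definition bump (a b w x : R) : R :=
  smoothstep (w * (x - a)) - smoothstep (w * (x - b)).

Lemma is_derive_bump (a b w x : R) : is_derive x 1 (bump a b w)
  (w * tent (w * (x - a)) - w * tent (w * (x - b))).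
Proof.
have -> : bump a b w = (fun y => smoothstep (w * (y - a))) -
   (fun y => smoothstep (w * (y - b))) by apply/funext.
by apply: is_deriveB; exact: is_derive_scaled_step.
Qed.

Lemma bump_bound (a b w x : R) : `|bump a b w x| <= 1.
Proof.
rewrite /bump; have := smoothstep_bound (w * (x - a)).
by have := smoothstep_bound (w * (x - b)); rewrite ler_norml; lra.
Qed.

Lemma bump_support (a b w : R) : a < b -> 0 < w ->
  [set x | bump a b w x != 0] `<=` `[a, b + w^-1].
Proof.
move=> ab w0 x /= /eqP xn0; rewrite in_itv/= !leNgt.
apply/andP; split; apply/negP => xab; apply: xn0; rewrite /bump.
  by rewrite !smoothstep_le0 ?subrr// pmulr_rle0//; lra.
have wv : w * w^-1 = 1 by rewrite divff// gt_eqF.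
have bx : w * (b + w^-1) < w * x by rewrite ltr_pM2l.
have wab : w * a < w * b by rewrite ltr_pM2l.
by rewrite !smoothstep_ge1 ?subrr// mulrBr; rewrite mulrDr wv in bx; lra.
Qed.

Lemma C1c_bump (a b w : R) : 0 < a -> a < b -> 0 < w -> w^-1 < 1 - b ->
  C1c (bump a b w).
Proof.
move=> a0 ab w0 wb.
have sub : closure [set x | bump a b w x != 0] `<=` `[a, b + w^-1].
  rewrite [X in _ `<=` X](_ : _ = closure `[a, b + w^-1]).
    exact/closureS/bump_support.
  by apply/closure_id; exact: itv_closed.
split.
- by move=> x; apply: ex_derive; exact: is_derive_bump.
- have -> : (bump a b w)^`()%classic =
      (fun x => w * tent (w * (x - a)) - w * tent (w * (x - b))).
    by apply/funext => x; exact/is_derive_derive1/is_derive_bump.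
  by move=> x; apply: cvgB; exact: continuous_scaled_tent.
- apply: subclosed_compact sub; first exact: closed_closure.
  exact: segment_compact.
- move=> x /sub /=; rewrite !in_itv/= => /andP[ax xb].
  by apply/andP; split; lra.
Qed.

(** Both ramps lie to the right of their base points, so the value at [a] stays 0 and the value at
    [b] is eventually 1; hence the half-open interval. *)
Lemma cvg_bump (a b x : R) : a < b ->
  \forall k \near \oo, bump a b k%:R x = \1_`]a, b] x.
Proof.
move=> ab; rewrite indicE.
have M : \forall k \near \oo, `|x - a|^-1 + `|x - b|^-1 + 1 <= k%:R :> R.
  exact: nbhs_infty_ger.
near=> k.
have hk : `|x - a|^-1 + `|x - b|^-1 + 1 <= k%:R :> R by near: k.
have xa0 : 0 <= `|x - a|^-1 by rewrite invr_ge0.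
have xb0 : 0 <= `|x - b|^-1 by rewrite invr_ge0.
have k0 : 0 < k%:R :> R by lra.
have big c : 0 < x - c -> `|x - c|^-1 <= k%:R -> 1 <= k%:R * (x - c).
  by move=> xc; rewrite gtr0_norm// => h; rewrite -ler_pdivrMr// mul1r.
have small c : x - c <= 0 -> k%:R * (x - c) <= 0.
  by move=> xc; rewrite pmulr_rle0.
rewrite /bump; have [xa|ax] := leP x a.
  rewrite !smoothstep_le0; [|by apply: small; lra|by apply: small; lra].
  rewrite memNset/= ?subrr// in_itv/=; lra.
have [xb|bx] := leP x b.
  rewrite smoothstep_ge1; last by apply: big; lra.
  rewrite smoothstep_le0; last by apply: small; lra.
  by rewrite mem_set/= ?subr0// in_itv/= ax xb.
rewrite !smoothstep_ge1; [|by apply: big; lra|by apply: big; lra].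
by rewrite memNset/= ?subrr// in_itv/=; lra.
Unshelve. all: by end_near. Qed.

(** The definition of the weak derivative is tested with [bump a b k%:R]. As [k] grows, one side
    tends to [r a - r b] by mollification, and the other to minus the integral of [gam] by dominated
    convergence. *)
Lemma weak_deriv_FTC_oo (r g gam : R -> R) (a b : R) :
  {within `[0, 1], continuous r} -> is_weak_deriv r g ->
  mu.-integrable `[0, 1] (EFin \o gam) ->
  {ae mu, forall x : R, 0 < x < 1 -> g x = gam x} ->
  0 < a -> a < b -> b < 1 ->
  r b - r a = \int[mu]_(x in `[a, b]) gam x.
Proof.
move=> cr [gi rg] gami ggam a0 ab b1.
have L : \int[mu]_(x in `[0, 1]) (r x * (bump a b k%:R)^`()%classic x)
    @[k --> \oo] --> r a - r b.
  have -> : (fun k : nat =>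
         \int[mu]_(x in `[0, 1]) (r x * (bump a b k%:R)^`()%classic x))
    = (fun k : nat =>
         \int[mu]_(x in `[0, 1]) (r x * (k%:R * tent (k%:R * (x - a))))
       - \int[mu]_(x in `[0, 1]) (r x * (k%:R * tent (k%:R * (x - b))))).
    apply/funext => k.
    have cT c : {within `[0, 1],
        continuous (fun y => k%:R * tent (k%:R * (y - c)) : R)}.
      apply: continuous_subspaceT; exact: continuous_scaled_tent.
    rewrite -RintegralB//=; first last.
    - by apply: continuous_integrable01 => x; apply: cvgM; [exact: cr|exact: cT].
    - by apply: continuous_integrable01 => x; apply: cvgM; [exact: cr|exact: cT].
    apply: eq_Rintegral => x _.
    by rewrite (is_derive_derive1 (is_derive_bump _ _ _ _)) mulrBr.
  by apply: cvgB; apply: cvg_mollify => //; apply/andP; split; lra.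
have mbump k : measurable_fun (`[0, 1] : set (measurableTypeR R)) (bump a b k).
  apply: subspace_continuous_measurable_fun => //.
  apply: continuous_subspaceT => x.
  exact: (is_derive_continuous (is_derive_bump _ _ _ _)).
have mgam : measurable_fun (`[0, 1] : set (measurableTypeR R)) gam.
  by apply/measurable_EFinP; exact: measurable_int gami.
have ibump k : mu.-integrable `[0, 1] (EFin \o (fun x => gam x * bump a b k x)).
  apply: le_integrable gami => //.
    by apply/measurable_EFinP; exact: measurable_funM.
  move=> x _ /=; rewrite lee_fin normrM ler_piMr//; exact: bump_bound.
have M : \int[mu]_(x in `[0, 1]) (gam x * bump a b k%:R x)
    @[k --> \oo] --> \int[mu]_(x in `]a, b]) gam x.
  have abE : `]a, b] = `[0, 1] `&` `]a, b] :> set R.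
    rewrite setIidr// => x /=; rewrite !in_itv/= => /andP[ax xb].
    by apply/andP; split; lra.
  have indE : \int[mu]_(x in `]a, b]) gam x =
      \int[mu]_(x in `[0, 1]) (gam x * \1_`]a, b] x).
    rewrite abE Rintegral_mkcondr; apply: eq_Rintegral => x x01.
    rewrite patchE indicE -abE; case: ifPn => _; first by rewrite mulr1.
    by rewrite mulr0.
  have iind : mu.-integrable `[0, 1] (EFin \o (fun x => gam x * \1_`]a, b] x)).
    apply: le_integrable gami => //.
      apply/measurable_EFinP; apply: measurable_funM => //.
    move=> x _ /=; rewrite lee_fin normrM ler_piMr//.
    by rewrite indicE; case: (_ \in _); rewrite ?normr1 ?normr0.
  have cae : {ae mu, forall x, `[0, 1] x ->
      (gam x * bump a b k%:R x)%:E @[k --> \oo] --> (gam x * \1_`]a, b] x)%:E}.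
    apply: aeW => x _; apply: cvg_near_cst.
    by apply: filterS (cvg_bump x ab) => k ->.
  have bae : {ae mu, forall x (k : nat), `[0, 1] x ->
      (`|(gam x * bump a b k%:R x)%:E| <= `|gam x|%:E)%E}.
    apply: aeW => x k _ /=; rewrite lee_fin normrM ler_piMr//; exact: bump_bound.
  have [_ _ H] := @dominated_convergence _ _ R mu _ (measurable_itv `[0, 1]%R)
     (fun k x => (gam x * bump a b k%:R x)%:E)
     (fun x => (gam x * \1_`]a, b] x)%:E) (fun x => `|gam x|%:E)
     (fun k => measurable_int mu (ibump k%:R)) (measurable_int mu iind)
     cae (integrable_norm gami) bae.
  rewrite indE; apply: fine_cvg; rewrite fineK; first exact: H.
  exact: integrable_fin_num.
have E : \forall k \near \oo,
   \int[mu]_(x in `[0, 1]) (r x * (bump a b k%:R)^`()%classic x) =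
   - \int[mu]_(x in `[0, 1]) (gam x * bump a b k%:R x).
  (* From this rank on, [b + k^-1 < 1], so the bump is supported inside []0, 1[] and is a legitimate
     test function. *)
  have N : \forall k \near \oo, (1 - b)^-1 + 1 <= k%:R :> R.
    exact: nbhs_infty_ger.
  near=> k.
  have hk : (1 - b)^-1 + 1 <= k%:R :> R by near: k.
  have b0 : 0 < (1 - b)^-1 by rewrite invr_gt0; lra.
  have k0 : 0 < k%:R :> R by lra.
  have kb : k%:R^-1 < 1 - b.
    by rewrite -[ltRHS]invrK ltf_pV2 ?posrE//; lra.
  have := rg _ (C1c_bump a0 ab k0 kb).
  have -> : \int[mu]_(x in `]0, 1[) (g x * bump a b k%:R x) =
            \int[mu]_(x in `]0, 1[) (gam x * bump a b k%:R x).
    congr fine; apply: eq_integral_ae.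
    apply: (@filterS _ _ (ae_filter_ringOfSetsType mu) _ _ _ ggam) => x gx.
    by rewrite /= in_itv/= => x01; rewrite gx.
  rewrite !Rintegral_itv_oo_cc//.
  have cb : {within `[0, 1], continuous (bump a b k%:R)^`()%classic}.
    by apply: continuous_subspaceT; case: (C1c_bump a0 ab k0 kb).
  by apply: continuous_integrable01 => x; apply: cvgM; [exact: cr|exact: cb].
have L' : (- (\int[mu]_(x in `[0, 1]) (gam x * bump a b k%:R x)))
    @[k --> \oo] --> r a - r b.
  by apply: cvg_trans L; apply: near_eq_cvg.
have M' : (- (\int[mu]_(x in `[0, 1]) (gam x * bump a b k%:R x)))
    @[k --> \oo] --> - (\int[mu]_(x in `]a, b]) gam x) by exact: cvgN.
have abI : r a - r b = - (\int[mu]_(x in `]a, b]) gam x).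
  exact: (cvg_unique (@Rhausdorff R) L' M').
rewrite -opprB abI opprK Rintegral_itv_obnd_cbnd//.
apply: integrable_sub01 gami => x /=; rewrite !in_itv/= => /andP[? ?].
by apply/andP; split; lra.
Unshelve. all: by end_near. Qed.

(** The difference [u] of [r] and the primitive of [gam] is constant on the open interval, and
    continuity carries this to the endpoints. The base point [2^-1] is arbitrary. *)
Lemma weak_deriv_FTC (r g gam : R -> R) (a b : R) :
  {within `[0, 1], continuous r} -> is_weak_deriv r g ->
  mu.-integrable `[0, 1] (EFin \o gam) ->
  {ae mu, forall x : R, 0 < x < 1 -> g x = gam x} ->
  0 <= a -> a <= b -> b <= 1 ->
  r b - r a = \int[mu]_(x in `[a, b]) gam x.
Proof.
move=> cr rg gami ggam a0 ab b1.
pose P x := \int[mu]_(t in `[0, x]) gam t.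
have cP : {within `[0, 1], continuous P}.
  exact: parameterized_integral_continuous.
have PB x y : 0 <= x -> x <= y -> y <= 1 ->
    P y - P x = \int[mu]_(t in `[x, y]) gam t.
  by move=> *; exact: primitiveB.
pose u x := r x - P x.
have cu : {within `[0, 1], continuous u}.
  by move=> x; apply: cvgB; [exact: cr|exact: cP].
have u2 x : 0 < x < 1 -> u x = u 2^-1.
  move=> x01; rewrite /u.
  have [xl|xl|->//] := ltgtP x 2^-1.
    have := weak_deriv_FTC_oo cr rg gami ggam (proj1 (andP x01)) xl _.
    by rewrite -PB; lra.
  have := @weak_deriv_FTC_oo _ _ _ 2^-1 x cr rg gami ggam _ xl (proj2 (andP x01)).
  by rewrite -PB; lra.
have [_ u0 u1] := (continuous_within_itvP _ (@ltr01 R)).1 cu.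
have uE x : 0 <= x <= 1 -> u x = u 2^-1.
  move=> /andP[]; rewrite le_eqVlt => /predU1P[<- _|x0].
    apply: (cvg_unique (@Rhausdorff R) u0); apply: cvg_near_cst.
    by near=> y; apply: u2; apply/andP; split.
  rewrite le_eqVlt => /predU1P[->|x1]; last by apply: u2; rewrite x0.
  apply: (cvg_unique (@Rhausdorff R) u1); apply: cvg_near_cst.
  by near=> y; apply: u2; apply/andP; split.
have uab : r a - P a = r b - P b.
  by rewrite -/(u a) -/(u b) !uE//; apply/andP; split; lra.
by rewrite -PB//; lra.
Unshelve. all: by end_near. Qed.

End FundamentalTheorem.

(** * Chain rule for powers of a continuous primitive *)

Section ChainRule.
Context {R : realType}.
Notation mu := (@lebesgue_measure R).

(* [F \o r^-1] has zero derivative. *)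
Lemma constant_of_quadratic_bound (F r : R -> R) (a b C : R) : a <= b ->
  {within `[a, b], continuous r} ->
  (forall x y, a <= x <= b -> a <= y <= b ->
     `|F y - F x| <= C * (r y - r x) ^+ 2) ->
  F a = F b.
Proof.
move=> ab cr Q.
have aab : a <= a <= b by rewrite lexx.
have bab : a <= b <= b by rewrite lexx andbT.
(* The range from [r a] to [r b] is cut into [N] equal steps, and the intermediate value theorem
   supplies a point at each level. Each step costs at most [C * ((r b - r a) / N%:R) ^+ 2], so the
   total is of order [N^-1]. *)
have step (N : nat) : (0 < N)%N -> forall k, (k <= N)%N ->
   forall x, a <= x <= b -> r x = r a + k%:R / N%:R * (r b - r a) ->
   `|F x - F a| <= k%:R * (C * ((r b - r a) / N%:R) ^+ 2).
  move=> N0; have NR : 0 < N%:R :> R by rewrite ltr0n.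
  elim=> [_|k IH kN] x xab rx.
    rewrite mul0r (le_trans (Q _ _ aab xab))//.
    by rewrite rx mul0r mul0r addr0 subrr expr0n mulr0.
  have kN1 : k%:R / N%:R <= 1 :> R by rewrite ler_pdivrMr// mul1r ler_nat ltnW.
  have k0 : 0 <= k%:R / N%:R :> R by rewrite divr_ge0.
  have vab : Num.min (r a) (r b) <= r a + k%:R / N%:R * (r b - r a)
      <= Num.max (r a) (r b).
    by have [rab|rab] := leP (r a) (r b); apply/andP; split; nra.
  have [y yab ry] := IVT ab cr vab.
  rewrite in_itv/= in yab.
  have -> : F x - F a = (F x - F y) + (F y - F a) by ring.
  apply: (le_trans (ler_normD _ _)).
  rewrite -natr1 mulrDl mul1r addrC; apply: lerD; first exact: IH (ltnW kN) _ yab ry.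
  apply: (le_trans (Q _ _ yab xab)); rewrite rx ry -natr1.
  rewrite le_eqVlt; apply/orP; left; apply/eqP; congr (_ * _ ^+ 2); field.
  by rewrite gt_eqF.
have bnd (N : nat) : (0 < N)%N -> `|F b - F a| * N%:R <= C * (r b - r a) ^+ 2.
  move=> N0; have NR : 0 < N%:R :> R by rewrite ltr0n.
  have := step N N0 N (leqnn N) b bab.
  rewrite divff ?gt_eqF// mul1r => /(_ (esym (subrKC _ _))) H.
  rewrite -ler_pdivlMr// (le_trans H)//.
  rewrite le_eqVlt; apply/orP; left; apply/eqP; field.
  by rewrite gt_eqF.
apply/eqP; rewrite eq_sym -subr_eq0 -normr_eq0.
apply: contraT => Fab.
have Fp : 0 < `|F b - F a| by rewrite lt_def Fab normr_ge0.
have := archi_boundP (normr_ge0 (C * (r b - r a) ^+ 2 / `|F b - F a|)).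
move/(le_lt_trans (ler_norm _)); set N := Num.bound _.
have := bnd N.+1 isT.
by rewrite ltr_pdivrMr// -natr1; nra.
Qed.

Lemma integral_itv_gt0 (f : R -> R) (a b : R) : a < b ->
  mu.-integrable `[a, b] (EFin \o f) -> (forall x, 0 < f x) ->
  0 < \int[mu]_(x in `[a, b]) f x.
Proof.
move=> ab fi f0; rewrite lt_def Rintegral_ge0 ?andbT => [|x _]; last exact: ltW.
apply/negP => /eqP I0.
have : (\int[mu]_(x in `[a, b]) `|(f x)%:E| = 0)%E.
  transitivity (\int[mu]_(x in `[a, b]) (f x)%:E)%E.
    by apply: eq_integral => x _; rewrite gee0_abs// lee_fin ltW.
  have := integrable_fin_num (measurable_itvR `[a, b]%R) fi.
  by move=> /fineK <-; rewrite [fine _]I0.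
move/(ae_eq_integral_abs mu (measurable_itvR `[a, b]%R) (measurable_int mu fi)).1.
move=> [N [mN N0 abN]].
have : (mu `[a, b]%classic <= mu N)%E.
  apply: le_measure; rewrite ?inE//.
  move=> x xab; apply: abN => /= /(_ xab) [fx0].
  by have := f0 x; rewrite fx0 ltxx.
by rewrite N0 lebesgue_measure_itv/= lte_fin ab -EFinD lee_fin; lra.
Qed.

(** Mean value bounds for [t ^+ m.+1] and a Lipschitz bound for [t ^+ m]. The constant [2 * M + 1]
    serves both exponents: 1 suffices for [m = 1] and [2 * M] for [m = 2]. *)
Lemma exprn_increments (m : nat) (x y M : R) : m = 1%N \/ m = 2%N ->
  0 <= x -> x <= y -> y <= M ->
  [/\ m.+1%:R * (x ^+ m * (y - x)) <= y ^+ m.+1 - x ^+ m.+1,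
      y ^+ m.+1 - x ^+ m.+1 <= m.+1%:R * (y ^+ m * (y - x)) &
      y ^+ m - x ^+ m <= (2 * M + 1) * (y - x)].
Proof.
move=> mE x0 xy yM.
have d0 : 0 <= y - x by lra.
have h1 : 0 <= (y - x) * (y - x) by exact: mulr_ge0.
have h2 : 0 <= (y - x) * (y - x) * (y + 2 * x) by apply: mulr_ge0 => //; lra.
have h3 : 0 <= (y - x) * (y - x) * (2 * y + x) by apply: mulr_ge0 => //; lra.
have h4 : 0 <= (y - x) * (2 * M - x - y) by apply: mulr_ge0 => //; lra.
have h5 : 0 <= (y - x) * M by apply: mulr_ge0 => //; lra.
by case: mE => ->; rewrite ?expr1 !exprS !expr0; split; nra.
Qed.

Section PositiveDerivative.
Variables (r gam : R -> R) (m : nat).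
Hypothesis m12 : m = 1%N \/ m = 2%N.
Hypothesis cr : {within `[0, 1], continuous r}.
Hypothesis gami : mu.-integrable `[0, 1] (EFin \o gam).
Hypothesis gam0 : forall x, 0 < gam x.
Hypothesis rgam : forall a b, 0 <= a -> a <= b -> b <= 1 ->
  r b - r a = \int[mu]_(x in `[a, b]) gam x.
Hypothesis r0 : 0 <= r 0.

Lemma primitive_increasing (a b : R) : 0 <= a -> a < b -> b <= 1 -> r a < r b.
Proof.
move=> a0 ab b1; rewrite -subr_gt0 (rgam a0 (ltW ab) b1).
apply: integral_itv_gt0 => //.
by apply: integrable_sub01 gami => x /=; rewrite !in_itv/= => /andP[? ?];
  apply/andP; split; lra.
Qed.

Lemma primitive_nondecreasing (a b : R) :
  0 <= a -> a <= b -> b <= 1 -> r a <= r b.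
Proof.
move=> a0; rewrite le_eqVlt => /predU1P[->//|ab] b1.
exact/ltW/primitive_increasing.
Qed.

Lemma primitive_bound (x : R) : 0 <= x <= 1 -> 0 <= r x <= r 1.
Proof.
move=> /andP[x0 x1]; rewrite primitive_nondecreasing// andbT.
exact: le_trans r0 (primitive_nondecreasing (lexx _) x0 x1).
Qed.

Lemma integrable_chain :
  mu.-integrable `[0, 1] (EFin \o (fun x => r x ^+ m * gam x)).
Proof.
apply: (le_integrable (measurable_itvR _) _ _
   (integrable_mulrl (r 1 ^+ m) (measurable_itvR _) gami)).
  apply/measurable_EFinP; apply: measurable_funM; last first.
    by apply/measurable_EFinP; exact: measurable_int gami.
  by apply: measurable_funX; apply: subspace_continuous_measurable_fun.
move=> x; rewrite /= in_itv/= => /primitive_bound /andP[rx0 rx1].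
have r10 : 0 <= r 1 by exact: le_trans rx0 rx1.
rewrite lee_fin !normrM ler_wpM2r// !ger0_norm ?exprn_ge0//.
exact: lerXn2r.
Qed.

(** Between [x] and [y], the increments of both sides lie between [m.+1%:R * r x ^+ m * (r y - r x)]
    and [m.+1%:R * r y ^+ m * (r y - r x)], because [r] is nondecreasing. Their difference [F] thus
    has increments quadratic in those of [r], which forces it to be constant. *)
Lemma chain_rule (b : R) : 0 <= b <= 1 ->
  r b ^+ m.+1 - r 0 ^+ m.+1 =
  m.+1%:R * \int[mu]_(x in `[0, b]) (r x ^+ m * gam x).
Proof.
move=> /andP[b0 b1].
pose F x := r x ^+ m.+1 - m.+1%:R * \int[mu]_(t in `[0, x]) (r t ^+ m * gam t).
have rpos t : 0 <= t -> t <= 1 -> 0 <= r t.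
  by move=> t0 t1; have /andP[] := primitive_bound (introT andP (conj t0 t1)).
have Q x y : 0 <= x -> x <= y -> y <= 1 ->
    `|F y - F x| <= m.+1%:R * (2 * r 1 + 1) * (r y - r x) ^+ 2.
  move=> x0 xy y1.
  have sub01 : `[x, y] `<=` `[0, 1].
    move=> t /=; rewrite !in_itv/= => /andP[? ?]; apply/andP; split; lra.
  have gi : mu.-integrable `[x, y] (EFin \o gam) by exact: integrable_sub01 gami.
  have ci : mu.-integrable `[x, y] (EFin \o (fun x => r x ^+ m * gam x)).
    exact: integrable_sub01 integrable_chain.
  have [] := exprn_increments m12 _ (primitive_nondecreasing x0 xy y1)
     (primitive_nondecreasing (le_trans x0 xy) y1 (lexx _)).
    by apply: rpos; lra.
  set I := \int[mu]_(t in `[x, y]) (r t ^+ m * gam t).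
  have Il : r x ^+ m * (r y - r x) <= I.
    rewrite rgam// -RintegralZl//; apply: le_Rintegral => //.
      exact: integrable_mulrl.
    move=> t; rewrite /= in_itv/= => /andP[xt ty].
    apply: ler_wpM2r; first exact: ltW.
    apply: lerXn2r; rewrite ?nnegrE; last by apply: primitive_nondecreasing; lra.
      by apply: rpos; lra.
    by apply: rpos; lra.
  have Iu : I <= r y ^+ m * (r y - r x).
    rewrite rgam// -RintegralZl//; apply: le_Rintegral => //.
      exact: integrable_mulrl.
    move=> t; rewrite /= in_itv/= => /andP[xt ty].
    apply: ler_wpM2r; first exact: ltW.
    apply: lerXn2r; rewrite ?nnegrE; last by apply: primitive_nondecreasing; lra.
      by apply: rpos; lra.
    by apply: rpos; lra.
  have FE : F y - F x = r y ^+ m.+1 - r x ^+ m.+1 - m.+1%:R * I.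
    by rewrite /F /I -(primitiveB x0 xy y1 integrable_chain); ring.
  move=> h1 h2 h3.
  have rxy := primitive_nondecreasing x0 xy y1.
  have H : (r y ^+ m - r x ^+ m) * (r y - r x) <=
      (2 * r 1 + 1) * (r y - r x) ^+ 2.
    by rewrite expr2 mulrA ler_wpM2r// subr_ge0.
  have m0 : 0 <= m.+1%:R :> R by [].
  rewrite FE -mulrA.
  have := ler_wpM2l m0 H; have := ler_wpM2l m0 Il; have := ler_wpM2l m0 Iu.
  by rewrite ler_norml mulrBl mulrBr; lra.
have : F 0 = F b.
  apply: (constant_of_quadratic_bound b0 (r := r)
     (C := m.+1%:R * (2 * r 1 + 1))).
    apply: continuous_subspaceW cr => x /=; rewrite !in_itv/= => /andP[? ?].
    by apply/andP; split; lra.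
  move=> x y /andP[x0 xb] /andP[y0 yb].
  have [xy|/ltW yx] := leP x y; first by apply: Q => //; lra.
  by rewrite distrC -(sqrrN (r y - r x)) [- (r y - r x)]opprB; apply: Q => //; lra.
by rewrite /F set_itv1 Rintegral_set1 mulr0 subr0 => ->; ring.
Qed.

End PositiveDerivative.

End ChainRule.

(** * Positive and classical versions of weak derivatives *)

Section SobolevRepresentatives.
Context {R : realType}.
Notation mu := (@lebesgue_measure R).

Lemma integrable_restrict01 (w : R -> R) (D : set (measurableTypeR R)) :
  measurable D ->
  mu.-integrable `]0, 1[ (EFin \o w) ->
  mu.-integrable D (EFin \o (w \_ `]0, 1[)).
Proof.
move=> mD wi; rewrite -restrict_EFin.
apply/(integrable_restrict mu (measurable_itvR `]0, 1[%R) mD).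
apply: (integrableS (measurable_itvR `]0, 1[%R)) wi => //.
by apply: measurableI => //; exact: measurable_itvR.
Qed.

Lemma weak_derivP (r : R -> R) : W11 r -> is_weak_deriv r (weak_deriv r).
Proof. by case=> _ _; exact: xgetPex. Qed.

(** The function is kept on the measurable set [A] where it is positive and replaced by 1 elsewhere.
    Positivity at every point makes the primitive strictly increasing and keeps the argument of [h]
    in its domain. *)
Lemma positive_representative (w : R -> R) :
  mu.-integrable `]0, 1[ (EFin \o w) ->
  {ae mu, forall x : R, 0 < x < 1 -> 0 < w x} ->
  exists gam : R -> R, [/\ mu.-integrable `[0, 1] (EFin \o gam),
    forall x, 0 < gam x &
    {ae mu, forall x : R, 0 < x < 1 -> w x = gam x}].
Proof.
move=> wi w0.
pose A := (`]0, 1[ : set (measurableTypeR R)) `&` w @^-1` `]0, +oo[.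
have mA : measurable A.
  have mw : measurable_fun (`]0, 1[ : set (measurableTypeR R)) w.
    by apply/measurable_EFinP; exact: measurable_int wi.
  by apply: mw; exact: measurable_itv.
pose w1 := w \_ `]0, 1[.
have w1i : mu.-integrable `[0, 1] (EFin \o w1).
  exact: integrable_restrict01 (measurable_itvR _) wi.
have mw1 : measurable_fun (`[0, 1] : set (measurableTypeR R)) w1.
  by apply/measurable_EFinP; exact: measurable_int w1i.
exists (fun x => w1 x * \1_A x + \1_(~` A) x); split.
- apply: integrable_addr; first exact: measurable_itvR.
    apply: le_integrable w1i; first exact: measurable_itvR.
      apply/measurable_EFinP; apply: measurable_funM => //.
    move=> x _ /=; rewrite lee_fin normrM ler_piMr//.
    by rewrite indicE; case: (_ \in _); rewrite ?normr1 ?normr0.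
  have i1 : mu.-integrable `[0, 1] (EFin \o cst (1 : R)).
    by apply: continuous_integrable01 => x; exact: cvg_cst.
  apply: le_integrable i1; first exact: measurable_itvR.
    by apply/measurable_EFinP/measurable_indic/measurableC.
  move=> x _ /=; rewrite lee_fin normr1.
  by rewrite indicE; case: (_ \in _); rewrite ?normr1 ?normr0.
- move=> x; rewrite !indicE.
  have [xA|xA] := pselect (A x).
    rewrite mem_set// memNset; last by apply.
    case: xA => x01 /=; rewrite in_itv/= andbT => wx.
    by rewrite mulr1 addr0 /w1 patchE mem_set.
  by rewrite memNset// mem_set// mulr0 add0r.
- apply: (@filterS _ _ (ae_filter_ringOfSetsType mu) _ _ _ w0) => x wx x01.
  have xi : `]0, 1[%classic x by rewrite /= in_itv.
  have xA : A x by split => //; rewrite /preimage/= in_itv/= wx.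
  rewrite !indicE mem_set// memNset; last by apply.
  by rewrite mulr1 addr0 /w1 patchE mem_set.
Qed.

Lemma weak_deriv_classical (s ds : R -> R) :
  {within `[0, 1], continuous s} -> {within `[0, 1], continuous ds} ->
  (forall x : R, 0 < x < 1 -> is_derive x 1 s (ds x)) ->
  is_weak_deriv s ds.
Proof.
move=> cs cds sD; split.
  by apply: integrable_sub01 (continuous_integrable01 cds); exact: subset_itv_oo_cc.
move=> phi [phiD cphi _ sub].
have phi0 x : ~ `]0, 1[%classic x -> phi x = 0.
  move=> x01; apply: contrapT => /eqP px; apply: x01; apply: sub.
  exact: subset_closure.
have phi0E : phi 0 = 0 by apply: phi0; rewrite /= in_itv/= ltxx.
have phi1E : phi 1 = 0 by apply: phi0; rewrite /= in_itv/= ltxx andbF.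
have phic : continuous phi.
  by move=> x; apply: differentiable_continuous; exact/derivable1_diffP.
have cphi' : {within `[0, 1], continuous phi^`()%classic}.
  exact: continuous_subspaceT.
have cphi0 : {within `[0, 1], continuous phi} by exact: continuous_subspaceT.
have [_ s0 s1] := (continuous_within_itvP _ (@ltr01 R)).1 cs.
rewrite !Rintegral_itv_oo_cc; first last.
- by apply: continuous_integrable01 => x; apply: cvgM; [exact: cs|exact: cphi'].
- by apply: continuous_integrable01 => x; apply: cvgM; [exact: cds|exact: cphi0].
rewrite (@Rintegration_by_parts _ s phi ds phi^`()%classic)//.
- by rewrite phi0E phi1E !mulr0 subr0 sub0r.
- by split=> // x; rewrite in_itv/= => /sD ?; exact: ex_derive.
- by move=> x; rewrite in_itv/= => /sD; exact: is_derive_derive1.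
- split=> [x _||]; first exact: phiD.
  + by apply: cvg_at_right_filter; exact: phic.
  + by apply: cvg_at_left_filter; exact: phic.
Qed.

(** Identifies the chosen [weak_deriv] of an explicit competitor: [s - s 0] is a primitive of [w],
    and by Lebesgue differentiation its derivative is [w] almost everywhere. *)
Lemma weak_deriv_ae_unique (s ds w : R -> R) :
  {within `[0, 1], continuous s} ->
  (forall x : R, 0 < x < 1 -> is_derive x 1 s (ds x)) ->
  is_weak_deriv s w ->
  {ae mu, forall x : R, 0 < x < 1 -> w x = ds x}.
Proof.
move=> cs sD sw; have [wi _] := sw.
pose w1 := w \_ `]0, 1[.
have w1i (D : set (measurableTypeR R)) :
    measurable D -> mu.-integrable D (EFin \o w1).
  by move=> mD; exact: integrable_restrict01 wi.
have w1l : locally_integrable setT w1.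
  by apply: integrable_locally => //; exact: measurable_itvR.
have w1E : {ae mu, forall x : R, 0 < x < 1 -> w x = w1 x}.
  by apply: aeW => x x01; rewrite /w1 patchE mem_set//= in_itv.
have F := @FTC1 _ w1 (BLeft 0) (fun y => w1i _ (measurable_itvR _)) w1l.
apply: (@filterS _ _ (ae_filter_ringOfSetsType mu) _ _ _ F) => x.
move=> Fx x01; have /andP[x0 x1] := x01.
have [|_ Px] := Fx; first by rewrite lte_fin.
rewrite (_ : w x = w1 x); last by rewrite /w1 patchE mem_set//= in_itv.
rewrite -Px; apply: is_derive_derive1.
apply: (@near_eq_is_derive _ _ _ (fun y => s y - s 0)).
  near=> y.
  have y0 : 0 < y by near: y; exact: lt_nbhsr.
  have y1 : y < 1 by near: y; exact: lt_nbhsl.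
  by rewrite (weak_deriv_FTC cs sw (w1i _ (measurable_itvR _)) w1E (lexx 0)
    (ltW y0) (ltW y1)).
have -> : ds x = ds x - 0 by rewrite subr0.
have D := sD x x01.
by apply: is_deriveB.
Unshelve. all: by end_near. Qed.

End SobolevRepresentatives.

(** * The stored energy and its tangent lines *)

Section StoredEnergy.
Context {R : realType}.
Variables (m : nat) (kappa : R) (h : R -> R).
Hypothesis kappa0 : 0 < kappa.
Hypothesis h_derivable : forall d : R, 0 < d -> derivable h d 1.
Hypothesis h_derivable2 : forall d : R, 0 < d -> derivable h^`()%classic d 1.
Hypothesis h_convex : forall d : R, 0 < d -> 0 < h^`(2)%classic d.

Definition stored_energy (nu v : R) : R :=
  kappa / m.+1%:R * nu ^+ m.+1 + h (nu * v ^+ m) +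
  kappa * (m.+1%:R - 1) * (nu * v ^+ m) * (m.+1%:R^-1 + ln v).

(* Minimum of [stored_energy nu v] at fixed determinant [nu * v ^+ m = d]; it
   is attained at [nu = v], and [That m.+1 kappa h v v] is its derivative at
   [v ^+ m.+1]. *)
Definition min_energy (d : R) : R :=
  kappa * d + h d + kappa * m%:R / m.+1%:R * (d * ln d).

Definition min_energy' (d : R) : R :=
  kappa + h^`()%classic d + kappa * m%:R / m.+1%:R * (ln d + 1).

Lemma natS_sub1 : m.+1%:R - 1 = m%:R :> R.
Proof. by rewrite -natr1 addrK. Qed.

(** With [d = nu * v ^+ m] and [y = (nu / v) ^+ m], the gap between the two sides is exactly
    [kappa / m.+1%:R * d * (y - 1 - ln y)]. *)
Lemma min_energy_le (nu v : R) : 0 < nu -> 0 < v ->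
  min_energy (nu * v ^+ m) <= stored_energy nu v.
Proof.
move=> nu0 v0; rewrite /min_energy /stored_energy natS_sub1.
have vm0 : 0 < v ^+ m by exact: exprn_gt0.
have d0 : 0 < nu * v ^+ m by exact: mulr_gt0.
have lnd : ln (nu * v ^+ m) = ln nu + m%:R * ln v.
  by rewrite lnM ?posrE// lnXn// mulr_natl.
have y0 : 0 < (nu / v) ^+ m by rewrite exprn_gt0// divr_gt0.
have := le_ln1Dx (_ : -1 < (nu / v) ^+ m - 1).
rewrite subrKC lnXn ?divr_gt0// ln_div ?posrE// -[_ *+ m]mulr_natl => /(_ _) H.
have {}H : m%:R * (ln nu - ln v) <= (nu / v) ^+ m - 1 by apply: H; lra.
have nuE : nu ^+ m.+1 = nu * v ^+ m * (nu / v) ^+ m.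
  by rewrite expr_div_n exprS -mulrA (mulrC (v ^+ m)) divfK// gt_eqF.
rewrite nuE lnd.
have n0 : 0 < m.+1%:R :> R by [].
set d := nu * v ^+ m in d0 *; set y := (nu / v) ^+ m in y0 H *.
have mE : m%:R = m.+1%:R - 1 :> R by rewrite natS_sub1.
rewrite -subr_ge0.
have -> : kappa / m.+1%:R * (d * y) + h d + kappa * m%:R * d * (m.+1%:R^-1 + ln v) -
   (kappa * d + h d + kappa * m%:R / m.+1%:R * (d * (ln nu + m%:R * ln v))) =
   kappa / m.+1%:R * d * ((y - 1) - m%:R * (ln nu - ln v)).
  by rewrite mE; field; rewrite gt_eqF.
by rewrite mulr_ge0 ?subr_ge0// mulr_ge0 ?divr_ge0// ltW.
Qed.

Lemma stored_energy_diag (v : R) : 0 < v ->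
  stored_energy v v = min_energy (v ^+ m.+1).
Proof.
move=> v0; rewrite /min_energy /stored_energy natS_sub1 exprS lnM ?posrE ?exprn_gt0//.
rewrite lnXn// -[_ *+ m]mulr_natl.
have mE : m%:R = m.+1%:R - 1 :> R by rewrite natS_sub1.
rewrite mE; field.
by rewrite gt_eqF.
Qed.

Lemma That_diag (v : R) : 0 < v ->
  That m.+1 kappa h v v = min_energy' (v ^+ m.+1).
Proof.
move=> v0; rewrite /That /min_energy' /= divff ?gt_eqF// expr1n natS_sub1 -exprS.
rewrite lnXn// -[_ *+ m.+1]mulr_natl; field.
by rewrite gt_eqF.
Qed.

Lemma h_cont (d : R) : 0 < d -> {for d, continuous h}.
Proof.
move=> d0; apply: differentiable_continuous; apply/derivable1_diffP.
exact: h_derivable.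
Qed.

Lemma within_continuous_pos (f : R -> R) (a b : R) : 0 < a ->
  (forall d, 0 < d -> {for d, continuous f}) -> {within `[a, b], continuous f}.
Proof.
move=> a0 cf; apply: continuous_in_subspaceT => x; rewrite inE/= in_itv/=.
by move=> /andP[ax _]; apply: cf; exact: lt_le_trans ax.
Qed.

Lemma h'_increasing (x y : R) : 0 < x -> x < y ->
  h^`()%classic x < h^`()%classic y.
Proof.
move=> x0 xy.
have [||c] := @MVT R h^`()%classic h^`(2)%classic x y xy.
- move=> z; rewrite in_itv/= => /andP[xz _].
  have z0 : 0 < z by exact: lt_trans xz.
  apply: DeriveDef; first exact: h_derivable2.
  by rewrite -derive1E.
- apply: within_continuous_pos => // d d0; apply: differentiable_continuous.
  by apply/derivable1_diffP; exact: h_derivable2.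
rewrite in_itv/= => /andP[xc _] E; rewrite -subr_gt0 E mulr_gt0 ?subr_gt0//.
by apply: h_convex; exact: lt_trans xc.
Qed.

Lemma h_tangent (d0 d : R) : 0 < d0 -> 0 < d -> d != d0 ->
  h d0 + h^`()%classic d0 * (d - d0) < h d.
Proof.
move=> d00 dp.
have mvt a b : 0 < a -> a < b -> exists2 c, a < c < b &
    h b - h a = h^`()%classic c * (b - a).
  move=> a0 ab; have [||c] := @MVT R h h^`()%classic a b ab.
  - move=> z; rewrite in_itv/= => /andP[az _].
    apply: DeriveDef; first by apply: h_derivable; exact: lt_trans az.
    by rewrite derive1E.
  - by apply: within_continuous_pos => //; exact: h_cont.
  by rewrite in_itv/= => ? ?; exists c.
rewrite neq_lt => /orP[ddlt|ddlt].
  have [c /andP[dc cd] E] := mvt _ _ dp ddlt.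
  have H := h'_increasing (lt_trans dp dc) cd.
  by have P : 0 < d0 - d; [lra|nra].
have [c /andP[dc cd] E] := mvt _ _ d00 ddlt.
have H := h'_increasing d00 dc.
by have P : 0 < d - d0; [lra|nra].
Qed.

(** After division by [d] this is [ln t <= t - 1] at [t = d0 / d]. *)
Lemma xlnx_tangent (d0 d : R) : 0 < d0 -> 0 < d ->
  d0 * ln d0 + (ln d0 + 1) * (d - d0) <= d * ln d.
Proof.
move=> d00 dp.
have y0 : 0 < d0 / d by exact: divr_gt0.
have := le_ln1Dx (_ : -1 < d0 / d - 1).
rewrite subrKC ln_div ?posrE// => /(_ _) H.
have {}H : ln d0 - ln d <= d0 / d - 1 by apply: H; lra.
have := ler_wpM2l (ltW dp) H.
have -> : d * (d0 / d - 1) = d0 - d by field; rewrite gt_eqF.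
by nra.
Qed.

Lemma min_energy_tangent_lt (d0 d : R) : 0 < d0 -> 0 < d -> d != d0 ->
  min_energy d0 + min_energy' d0 * (d - d0) < min_energy d.
Proof.
move=> d00 dp dd; have h1 := h_tangent d00 dp dd.
have k0 : 0 <= kappa * m%:R / m.+1%:R.
  by rewrite divr_ge0// mulr_ge0// ltW.
have := ler_wpM2l k0 (xlnx_tangent d00 dp).
rewrite /min_energy /min_energy'; set k := kappa * m%:R / m.+1%:R; nra.
Qed.

Lemma min_energy_tangent (d0 d : R) : 0 < d0 -> 0 < d ->
  min_energy d0 + min_energy' d0 * (d - d0) <= min_energy d.
Proof.
move=> d00 dp; have [->|dd] := eqVneq d d0; first by rewrite subrr mulr0 addr0.
exact/ltW/min_energy_tangent_lt.
Qed.

End StoredEnergy.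

Section IntegrableOfGe.
Context d (T : measurableType d) (R : realType) (mu : {measure set T -> \bar R}).

(** The minorant [q] makes the negative part integrable, so an integral below [+oo] rules out an
    infinite positive part. *)
Lemma integrable_of_ge (D : set T) (f q : T -> R) : measurable D ->
  measurable_fun D f -> mu.-integrable D (EFin \o q) ->
  (forall x, D x -> q x <= f x) ->
  (\int[mu]_(x in D) (f x)%:E < +oo)%E -> mu.-integrable D (EFin \o f).
Proof.
move=> mD mf qi qf If.
have mf' : measurable_fun D (EFin \o f) by exact/measurable_EFinP.
have neg : (\int[mu]_(x in D) (EFin \o f)^\- x < +oo)%E.
  apply: le_lt_trans (integral_funeneg_lt_pinfty mD qi).
  apply: ge0_le_integral => //.
  - exact: measurable_funeneg.
  - by apply: measurable_funeneg; exact: measurable_int qi.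
  - move=> x Dx; rewrite !funenegE; have := qf x Dx; rewrite -lee_fin => qfx.
    by rewrite le_max2// leeN2.
have neg0 : (0 <= \int[mu]_(x in D) (EFin \o f)^\- x)%E by exact: integral_ge0.
apply/integrableP; split => //.
rewrite -[fun x => _]/(abse \o (EFin \o f)) fune_abse ge0_integralD//; first last.
- exact: measurable_funeneg.
- exact: measurable_funepos.
move: If neg neg0; rewrite integralE.
have : (0 <= \int[mu]_(x in D) (EFin \o f)^\+ x)%E by exact: integral_ge0.
case: (\int[mu]_(x in D) (EFin \o f)^\+ x)%E => [a| |] //.
  by case: (\int[mu]_(x in D) (EFin \o f)^\- x)%E => [b| |] // *; exact: ltry.
by case: (\int[mu]_(x in D) (EFin \o f)^\- x)%E => [b| |].
Qed.

End IntegrableOfGe.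

(** * Lower bound and rigidity for the energy *)

Section EnergyBounds.
Context {R : realType}.
Notation mu := (@lebesgue_measure R).
Variables (m : nat) (kappa : R) (h : R -> R).
Hypothesis m12 : m = 1%N \/ m = 2%N.
Hypothesis kappa0 : 0 < kappa.
Hypothesis h_derivable : forall d : R, 0 < d -> derivable h d 1.
Hypothesis h_derivable2 : forall d : R, 0 < d -> derivable h^`()%classic d 1.
Hypothesis h_convex : forall d : R, 0 < d -> 0 < h^`(2)%classic d.

Definition energy_density (gam r : R -> R) (x : R) : R :=
  x ^+ m * stored_energy m kappa h (gam x) (r x / x).

(** Continuity of [h] is known only on the positive reals, so [h] is composed as a function on []0,
    +oo[]; positivity of [gam] and [r] keeps the determinant there. *)
Lemma measurable_energy_density (gam r : R -> R) :
  measurable_fun (`]0, 1[ : set (measurableTypeR R)) gam ->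
  measurable_fun (`]0, 1[ : set (measurableTypeR R)) r ->
  (forall x, 0 < x < 1 -> 0 < gam x) -> (forall x, 0 < x < 1 -> 0 < r x) ->
  measurable_fun (`]0, 1[ : set (measurableTypeR R)) (energy_density gam r).
Proof.
move=> mg mr g0 r0.
have mv : measurable_fun (`]0, 1[ : set (measurableTypeR R)) (fun x => r x / x).
  apply: measurable_funM => //; apply: open_continuous_measurable_fun.
    exact: interval_open.
  move=> x; rewrite inE/= in_itv/= => /andP[x0 _].
  by apply: inv_continuous; rewrite gt_eqF.
have md : measurable_fun (`]0, 1[ : set (measurableTypeR R))
    (fun x => gam x * (r x / x) ^+ m).
  by apply: measurable_funM => //; exact: measurable_funX.
apply: measurable_funM; first exact: measurable_funX.
apply: measurable_funD.
  apply: measurable_funD.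
    by apply: measurable_funM => //; exact: measurable_funX.
  apply: (@measurable_comp _ _ _ _ _ _ (`]0, +oo[ : set (measurableTypeR R)) h) => //.
    move=> _ /= [x /= x01 <-]; rewrite in_itv/= in x01.
    have /andP[x0 _] := x01.
    rewrite in_itv/= andbT mulr_gt0 ?g0// exprn_gt0// divr_gt0//; exact: r0.
  apply: open_continuous_measurable_fun; first exact: interval_open.
  by move=> x; rewrite inE/= in_itv/= andbT; exact: h_cont.
apply: measurable_funM; first exact: measurable_funM.
apply: measurable_funD => //.
by apply: measurableT_comp => //; exact: measurable_ln.
Qed.

Lemma primitive1 (a b : R) : 0 <= a -> a <= b -> b <= 1 ->
  b - a = \int[mu]_(x in `[a, b]) 1.
Proof.
move=> a0 ab b1; rewrite Rintegral_cst; last exact: measurable_itvR.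
rewrite mul1r [X in fine X](_ : _ = (b - a)%:E)//.
apply: (etrans (lebesgue_measure_itv `[a, b]%R)); rewrite /= lte_fin; move: ab.
by rewrite le_eqVlt => /predU1P[->|->//]; rewrite ltxx subrr.
Qed.

Lemma integrable_exprn :
  mu.-integrable `[0, 1] (EFin \o (fun x : R => x ^+ m)).
Proof.
apply: continuous_integrable01; apply: continuous_subspaceT => x.
exact: exprn_continuous.
Qed.

Lemma integral_exprn (b : R) : 0 <= b <= 1 ->
  b ^+ m.+1 = m.+1%:R * \int[mu]_(x in `[0, b]) x ^+ m.
Proof.
move=> b01.
have c1 : {within `[0, 1], continuous (fun x : R => x)}.
  by apply: continuous_subspaceT => x; exact: cvg_id.
have i1 : mu.-integrable `[0, 1] (EFin \o cst (1 : R)).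
  by apply: continuous_integrable01 => x; exact: cvg_cst.
(* The chain rule applied to the identity, whose derivative is the constant 1. *)
have := chain_rule m12 c1 i1 (fun=> ltr01) primitive1 (lexx 0) b01.
rewrite expr0n subr0 => ->; congr (_ * _).
by apply: eq_Rintegral => x _; rewrite mulr1.
Qed.

Section Admissible.
Variables (lambda : R) (r gam : R -> R).
Hypothesis r1 : r 1 = lambda.
Hypothesis cr : {within `[0, 1], continuous r}.
Hypothesis gami : mu.-integrable `[0, 1] (EFin \o gam).
Hypothesis gam0 : forall x, 0 < gam x.
Hypothesis rgam : forall a b, 0 <= a -> a <= b -> b <= 1 ->
  r b - r a = \int[mu]_(x in `[a, b]) gam x.
Hypothesis r0 : 0 <= r 0.

Let L := lambda ^+ m.+1.

(* [x ^+ m] times the tangent line of [min_energy] at [L], at the determinant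
   [gam x * (r x / x) ^+ m]; written so as to be defined at 0. *)
Definition tangent_density (x : R) : R :=
  (min_energy m kappa h L - min_energy' m kappa h L * L) * x ^+ m +
  min_energy' m kappa h L * (r x ^+ m * gam x).

Lemma admissible_gt0 (x : R) : 0 < x -> x <= 1 -> 0 < r x.
Proof.
move=> x0 x1; apply: le_lt_trans r0 _.
exact: (primitive_increasing gami gam0 rgam).
Qed.

Lemma lambda_gt0 : 0 < lambda.
Proof. by rewrite -r1; apply: admissible_gt0; lra. Qed.

Lemma tangent_densityE (x : R) : 0 < x -> x <= 1 ->
  tangent_density x = x ^+ m * (min_energy m kappa h L + min_energy' m kappa h L
     * (gam x * (r x / x) ^+ m - L)).
Proof.
move=> x0 x1; rewrite /tangent_density expr_div_n.
set M := min_energy _ _ _ _; set M' := min_energy' _ _ _ _.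
have -> : x ^+ m * (M + M' * (gam x * (r x ^+ m / x ^+ m) - L)) =
  (M - M' * L) * x ^+ m + M' * gam x * r x ^+ m * (x ^+ m / x ^+ m) by ring.
by rewrite divff ?mulr1 ?gt_eqF ?exprn_gt0//; ring.
Qed.

Lemma tangent_density_le (x : R) : 0 < x < 1 ->
  tangent_density x <= energy_density gam r x.
Proof.
move=> /andP[x0 x1]; rewrite (tangent_densityE x0 (ltW x1)) /energy_density.
rewrite ler_pM2l ?exprn_gt0//.
have v0 : 0 < r x / x by rewrite divr_gt0// admissible_gt0// ltW.
apply: (@le_trans _ _ (min_energy m kappa h (gam x * (r x / x) ^+ m))); last first.
  exact: min_energy_le.
apply: min_energy_tangent => //; first by rewrite exprn_gt0// lambda_gt0.
by rewrite mulr_gt0// exprn_gt0.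
Qed.

(** A determinant other than [L] would put [min_energy] strictly above its tangent line, while
    [stored_energy] is at least [min_energy]. *)
Lemma tangent_density_eq (x : R) : 0 < x < 1 ->
  energy_density gam r x = tangent_density x ->
  r x ^+ m * gam x = L * x ^+ m.
Proof.
move=> /andP[x0 x1]; rewrite (tangent_densityE x0 (ltW x1)).
have v0 : 0 < r x / x by rewrite divr_gt0// admissible_gt0// ltW.
move=> /(mulfI _) E; have {E} := E (lt0r_neq0 (exprn_gt0 _ x0)).
have dp : 0 < gam x * (r x / x) ^+ m by rewrite mulr_gt0// exprn_gt0.
have Lp : 0 < L by rewrite exprn_gt0// lambda_gt0.
have [dL _|dL E] := eqVneq (gam x * (r x / x) ^+ m) L.
  by rewrite -dL expr_div_n -mulrA divfK 1?mulrC// gt_eqF// exprn_gt0.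
have := min_energy_tangent_lt m kappa0 h_derivable h_derivable2 h_convex Lp dp dL.
by rewrite -E ltNge min_energy_le.
Qed.

Lemma integrable_tangent_density :
  mu.-integrable `[0, 1] (EFin \o tangent_density).
Proof.
apply: integrable_addr; first exact: measurable_itvR.
  apply: integrable_mulrl; first exact: measurable_itvR.
  exact: integrable_exprn.
apply: integrable_mulrl; first exact: measurable_itvR.
exact: (integrable_chain m cr gami gam0 rgam r0).
Qed.

Lemma integral_tangent_density :
  \int[mu]_(x in `]0, 1[) tangent_density x =
  (min_energy m kappa h L - min_energy' m kappa h L * r 0 ^+ m.+1) / m.+1%:R.
Proof.
have b01 : 0 <= (1 : R) <= 1 by apply/andP; split; lra.
rewrite Rintegral_itv_oo_cc; last exact: integrable_tangent_density.
rewrite RintegralD; last 3 first.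
- exact: measurable_itvR.
- by apply: integrable_mulrl; [exact: measurable_itvR|exact: integrable_exprn].
- apply: integrable_mulrl; [exact: measurable_itvR|].
  exact: (integrable_chain m cr gami gam0 rgam r0).
rewrite !RintegralZl; last 4 first.
- exact: measurable_itvR.
- exact: (integrable_chain m cr gami gam0 rgam r0).
- exact: measurable_itvR.
- exact: integrable_exprn.
have := chain_rule m12 cr gami gam0 rgam r0 b01; rewrite r1 -/L.
have := integral_exprn b01; rewrite expr1n.
set I := \int[mu]_(x in _) _; set J := \int[mu]_(x in _) _ => II JJ.
have n0 : m.+1%:R != 0 :> R by [].
have -> : I = 1 / m.+1%:R.
  by apply: (mulfI n0); rewrite -II mulrCA divff// mulr1.
have -> : J = (L - r 0 ^+ m.+1) / m.+1%:R.
  by apply: (mulfI n0); rewrite -JJ mulrCA divff// mulr1.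
by ring.
Qed.

Hypothesis Ilty :
  (\int[mu]_(x in `]0%R, 1%R[) (energy_density gam r x)%:E < +oo)%E.

Lemma integrable_energy_density :
  mu.-integrable `]0, 1[ (EFin \o energy_density gam r).
Proof.
apply: integrable_of_ge Ilty.
- exact: measurable_itvR.
- apply: measurable_energy_density => //.
  + apply: (measurable_funS (measurable_itvR `[0, 1]%R)).
      exact: subset_itv_oo_cc.
    by apply/measurable_EFinP; exact: measurable_int gami.
  + apply: (measurable_funS (measurable_itvR `[0, 1]%R)).
      exact: subset_itv_oo_cc.
    by apply: subspace_continuous_measurable_fun.
  + by move=> x /andP[x0 x1]; apply: admissible_gt0 => //; exact: ltW.
- apply: integrable_sub01 integrable_tangent_density.
  exact: subset_itv_oo_cc.
- by move=> x; rewrite /= in_itv/=; exact: tangent_density_le.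
Qed.

Lemma energy_excess :
  \int[mu]_(x in `]0, 1[) (energy_density gam r x - tangent_density x) =
  \int[mu]_(x in `]0, 1[) energy_density gam r x -
  (min_energy m kappa h L - min_energy' m kappa h L * r 0 ^+ m.+1) / m.+1%:R.
Proof.
rewrite RintegralB ?integral_tangent_density//.
- exact: integrable_energy_density.
- apply: integrable_sub01 integrable_tangent_density.
  exact: subset_itv_oo_cc.
Qed.

Lemma energy_excess_ge0 :
  0 <= \int[mu]_(x in `]0, 1[) (energy_density gam r x - tangent_density x).
Proof.
apply: Rintegral_ge0 => x; rewrite /= in_itv/= => x01.
by rewrite subr_ge0 tangent_density_le.
Qed.

Lemma energy_density_rigid : min_energy' m kappa h L < 0 ->
  \int[mu]_(x in `]0, 1[) energy_density gam r x <=
    min_energy m kappa h L / m.+1%:R ->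
  forall x, 0 <= x <= 1 -> r x = lambda * x.
Proof.
move=> M'0 I_le.
have n0 : 0 < m.+1%:R :> R by [].
have r0n : 0 <= r 0 ^+ m.+1 by exact: exprn_ge0.
have M'r0 : 0 <= - (min_energy' m kappa h L * r 0 ^+ m.+1 / m.+1%:R).
  by rewrite -!mulNr divr_ge0// mulr_ge0// oppr_ge0 ltW.
have E0 := energy_excess_ge0; have E1 := energy_excess.
set E := \int[mu]_(x in _) (_ - _) in E0 E1.
set I := \int[mu]_(x in _) _ in I_le E1; rewrite mulrBl in E1.
(* The energy minus [min_energy m kappa h L / m.+1%:R] is the excess [E] plus the cavity term
   [M'r0]. Both are nonnegative and their sum is not positive, so both vanish. *)
have M'r00 : min_energy' m kappa h L * r 0 ^+ m.+1 / m.+1%:R = 0.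
  move: (_ * _ / _) (min_energy m kappa h L / _) M'r0 I_le E0 E1.
  by clearbody E I => P Q *; lra.
have E00 : \int[mu]_(x in `]0, 1[)
    (energy_density gam r x - tangent_density x) = 0.
  rewrite -/E; move: E0 E1 I_le; rewrite M'r00; clearbody E I.
  by move: (min_energy m kappa h L / _) => Q *; lra.
have r00 : r 0 = 0.
  move/eqP: M'r00; rewrite !mulf_eq0 invr_eq0 (lt_eqF M'0) (gt_eqF n0) orbF/=.
  by rewrite expf_eq0/= => /eqP.
have D01 : measurable (`]0, 1[ : set (measurableTypeR R)) by exact: measurable_itvR.
have ei : mu.-integrable `]0, 1[
    (EFin \o (fun x => energy_density gam r x - tangent_density x)).
  apply: integrable_subr => //; first exact: integrable_energy_density.
  apply: integrable_sub01 integrable_tangent_density; exact: subset_itv_oo_cc.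
have ae0 : {ae mu, forall x : R, `]0, 1[%classic x ->
    (energy_density gam r x - tangent_density x)%:E = 0%E}.
  apply: (ae_eq_integral_abs mu D01 (measurable_int mu ei)).1.
  transitivity (\int[mu]_(x in `]0%R, 1%R[)
      (energy_density gam r x - tangent_density x)%:E)%E.
    apply: eq_integral => x; rewrite inE/= in_itv/= => x01.
    by rewrite ger0_norm// subr_ge0 tangent_density_le.
  by have := integrable_fin_num D01 ei => /fineK <-; rewrite [fine _]E00.
move=> x x01; have /andP[x0 x1] := x01.
have := chain_rule m12 cr gami gam0 rgam r0 x01; rewrite r00 expr0n/= subr0.
have -> : \int[mu]_(t in `[0, x]) (r t ^+ m * gam t) =
   \int[mu]_(t in `[0, x]) (L * t ^+ m).
  congr fine; apply: eq_integral_ae.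
  (* The pointwise identity holds only inside []0, 1[], whereas the integral runs over [[0, x]] with
     [x = 1] allowed; the points 0 and 1 are discarded as null sets. *)
  have N (c : R) : {ae mu, forall t : R, t != c}.
    exists [set c]; split; [exact: measurable_set1|exact: lebesgue_measure_set1|].
    by move=> t /= /negP; rewrite negbK => /eqP.
  have F := ae_filter_ringOfSetsType mu.
  apply: filterS3 (N 0) (N 1) ae0 => t t0 t1 /= tE; rewrite in_itv/= => /andP[t0' tx].
  have t01 : 0 < t < 1 by rewrite !lt_def t0 t0' eq_sym t1 (le_trans tx).
  congr EFin; apply: tangent_density_eq => //; apply/eqP; rewrite -subr_eq0.
  by apply/eqP; move: tE; rewrite in_itv/= => /(_ t01) [].
rewrite RintegralZl; last 2 first.
- exact: measurable_itvR.
- apply: integrable_sub01 integrable_exprn => t /=; rewrite !in_itv/=.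
  by move=> /andP[-> /le_trans]; apply.
rewrite mulrCA -integral_exprn// /L -exprMn => /eqP.
have rx0 : 0 <= r x.
  by rewrite (le_trans r0)// (primitive_nondecreasing gami gam0 rgam).
have l0 := lambda_gt0.
by rewrite eqrXn2// ?mulr_ge0// ?(ltW l0)// => /eqP.
Qed.

Lemma energy_density_lower : r 0 = 0 ->
  min_energy m kappa h L / m.+1%:R <=
  \int[mu]_(x in `]0, 1[) energy_density gam r x.
Proof.
move=> r00; have := energy_excess_ge0; rewrite energy_excess r00 expr0n/= mulr0 subr0.
by rewrite subr_ge0.
Qed.

End Admissible.

End EnergyBounds.

(** * Competitors *)

Section Competitors.
Context {R : realType}.
Notation mu := (@lebesgue_measure R).
Variables (m : nat) (kappa : R) (h : R -> R).
Hypothesis m12 : m = 1%N \/ m = 2%N.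
Hypothesis kappa0 : 0 < kappa.
Hypothesis h_ge0 : forall d : R, 0 < d -> 0 <= h d.
Hypothesis h_derivable : forall d : R, 0 < d -> derivable h d 1.

Lemma integral_density_ae (r gam : R -> R) :
  {ae mu, forall x : R, 0 < x < 1 -> weak_deriv r x = gam x} ->
  (\int[mu]_(x in `]0%R, 1%R[) (Ihat_density m.+1 kappa h r x)%:E =
   \int[mu]_(x in `]0%R, 1%R[) (energy_density m kappa h gam r x)%:E)%E.
Proof.
move=> wE; apply: eq_integral_ae.
apply: (@filterS _ _ (ae_filter_ringOfSetsType mu) _ _ _ wE) => x wx.
rewrite /= in_itv/= => x01.
by rewrite /Ihat_density /delta wx.
Qed.

Lemma admissible_representative (lambda : R) (r : R -> R) :
  admissible lambda r -> exists gam : R -> R,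
  [/\ mu.-integrable `[0, 1] (EFin \o gam), forall x, 0 < gam x,
      {ae mu, forall x : R, 0 < x < 1 -> weak_deriv r x = gam x} &
      forall a b, 0 <= a -> a <= b -> b <= 1 ->
        r b - r a = \int[mu]_(x in `[a, b]) gam x].
Proof.
move=> [rW _ wd0 _]; have rD := weak_derivP rW; have [wi _] := rD.
have [gam [gami gam0 gamE]] := positive_representative wi wd0.
exists gam; split => // a b a0 ab b1; have [cr _ _] := rW.
exact: (weak_deriv_FTC cr rD gami gamE).
Qed.

Section Classical.
Variables (s ds : R -> R).
Hypothesis cs : {within `[0, 1], continuous s}.
Hypothesis cds : {within `[0, 1], continuous ds}.
Hypothesis sD : forall x : R, 0 < x < 1 -> is_derive x 1 s (ds x).

Lemma classical_W11 : W11 s.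
Proof.
split => //; last by exists ds; exact: weak_deriv_classical.
by apply: integrable_sub01 (continuous_integrable01 cs); exact: subset_itv_oo_cc.
Qed.

Lemma classical_weak_deriv :
  {ae mu, forall x : R, 0 < x < 1 -> weak_deriv s x = ds x}.
Proof. exact: weak_deriv_ae_unique (weak_derivP classical_W11). Qed.

Lemma classical_admissible : (forall x, 0 < x < 1 -> 0 < ds x) -> 0 <= s 0 ->
  admissible (s 1) s.
Proof.
move=> ds0 s0; split => //; first exact: classical_W11.
apply: (@filterS _ _ (ae_filter_ringOfSetsType mu) _ _ _ classical_weak_deriv).
by move=> x sx x01; rewrite sx// ds0.
Qed.

End Classical.

Lemma linear_competitor (lambda : R) : 0 < lambda ->
  admissible lambda (fun x => lambda * x) /\
  (\int[mu]_(x in `]0%R, 1%R[)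
     (Ihat_density m.+1 kappa h (fun x => lambda * x) x)%:E =
   (min_energy m kappa h (lambda ^+ m.+1) / m.+1%:R)%:E)%E.
Proof.
move=> l0; set s := fun x : R => lambda * x.
have cs : {within `[0, 1], continuous s}.
  apply: continuous_subspaceT => x.
  by apply: cvgM; [exact: cvg_cst|exact: cvg_id].
have cds : {within `[0, 1], continuous (fun _ : R => lambda)}.
  by move=> x; exact: cvg_cst.
have sD (x : R) : 0 < x < 1 -> is_derive x 1 s lambda.
  move=> _; have -> : s = lambda \*: id by apply/funext.
  by apply: is_derive_eq; rewrite /GRing.scale/= mulr1.
split.
  have := classical_admissible cs cds sD (fun _ _ => l0) _.
  by rewrite /s mulr1; apply; rewrite mulr0.
rewrite (integral_density_ae (classical_weak_deriv cs cds sD)).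
transitivity (\int[mu]_(x in `]0%R, 1%R[)
   (min_energy m kappa h (lambda ^+ m.+1) * x ^+ m)%:E)%E.
  apply: eq_integral => x; rewrite inE/= in_itv/= => /andP[x0 x1].
  by rewrite /energy_density /s mulfK ?gt_eqF// stored_energy_diag// mulrC.
have ei := integrable_mulrl (min_energy m kappa h (lambda ^+ m.+1))
   (measurable_itvR `[0, 1]%R) (integrable_exprn m).
have ei' := integrable_sub01 (@subset_itv_oo_cc _ _ 0 1) ei.
rewrite -(fineK (integrable_fin_num (measurable_itvR `]0, 1[%R) ei')).
congr EFin.
have := Rintegral_itv_oo_cc ei; rewrite /Rintegral => ->.
rewrite [LHS](RintegralZl _ (measurable_itvR `[0, 1]%R) (integrable_exprn m)).
have b01 : 0 <= (1 : R) <= 1 by apply/andP; split; lra.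
congr (_ * _); apply: (mulfI (_ : m.+1%:R != 0)) => //.
by rewrite -integral_exprn// expr1n divff.
Qed.

Section Cavity.
Variable lambda : R.
Hypothesis lambda1 : 1 < lambda.

Let c := lambda ^+ m.+1 - 1.

(* The radial map with [delta = 1] that satisfies [cavity 1 = lambda]. *)
Definition cavity (x : R) : R := (x ^+ m.+1 + c) `^ m.+1%:R^-1.

Definition cavity' (x : R) : R := x ^+ m * (x ^+ m.+1 + c) `^ (m.+1%:R^-1 - 1).

Lemma cavity_c_gt0 : 0 < c.
Proof. by rewrite subr_gt0 exprn_egt1. Qed.

Lemma cavity_base_gt0 (x : R) : 0 <= x -> 0 < x ^+ m.+1 + c.
Proof. by move=> x0; rewrite ltr_wpDl ?exprn_ge0// cavity_c_gt0. Qed.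

Lemma cavity_gt0 (x : R) : 0 <= x -> 0 < cavity x.
Proof. by move=> x0; rewrite powR_gt0// cavity_base_gt0. Qed.

Lemma cavity_exprn (x : R) : 0 <= x -> cavity x ^+ m.+1 = x ^+ m.+1 + c.
Proof.
move=> x0; rewrite -powR_mulrn ?powR_ge0// -powRrM mulVf// powRr1//.
exact/ltW/cavity_base_gt0.
Qed.

Lemma is_derive_base (x : R) :
  is_derive x 1 (fun y : R => y ^+ m.+1 + c) (m.+1%:R * x ^+ m).
Proof.
have -> : (fun y : R => y ^+ m.+1 + c) = (@id R) ^+ m.+1 + cst c.
  by apply/funext => y; rewrite !fctE.
apply: is_derive_eq; rewrite /GRing.scale/= addr0 mulr1.
by rewrite mulr_natl.
Qed.

Lemma is_derive_base_powR (x a : R) : 0 <= x ->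
  is_derive x 1 (fun y : R => (y ^+ m.+1 + c) `^ a)
    (a * (x ^+ m.+1 + c) `^ (a - 1) * (m.+1%:R * x ^+ m)).
Proof.
move=> x0.
have -> : (fun y : R => (y ^+ m.+1 + c) `^ a) =
  (@powR R ^~ a) \o (fun y : R => y ^+ m.+1 + c) by [].
apply: is_derive1_comp; last exact: is_derive_base.
exact/is_derive1_powR/cavity_base_gt0.
Qed.

Lemma is_derive_cavity (x : R) : 0 <= x -> is_derive x 1 cavity (cavity' x).
Proof.
move=> x0; have D := is_derive_base_powR m.+1%:R^-1 x0.
by apply: is_derive_eq; rewrite /cavity'; field.
Qed.

Lemma within_continuous_base_powR (a : R) :
  {within `[0, 1], continuous (fun y : R => (y ^+ m.+1 + c) `^ a)}.
Proof.
apply: continuous_in_subspaceT => x; rewrite inE/= in_itv/= => /andP[x0 _].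
exact: is_derive_continuous (is_derive_base_powR a x0).
Qed.

Lemma cavity_ge (x : R) : 0 <= x -> x <= cavity x.
Proof.
move=> x0; rewrite -(ler_pXn2r (ltn0Sn m)) ?nnegrE// ?cavity_exprn//.
  by rewrite lerDl ltW// cavity_c_gt0.
exact/ltW/cavity_gt0.
Qed.

Lemma cavity_le (x : R) : 0 <= x -> x <= 1 -> cavity x <= lambda.
Proof.
move=> x0 x1; have l0 : 0 <= lambda by exact: ltW (lt_trans ltr01 lambda1).
have cx0 := ltW (cavity_gt0 x0).
rewrite -(ler_pXn2r (ltn0Sn m)) ?nnegrE// cavity_exprn//.
by rewrite /c addrCA gerDl subr_le0; exact: exprn_ile1.
Qed.

Lemma cavity_1 : cavity 1 = lambda.
Proof.
have l0 : 0 <= lambda by exact: ltW (lt_trans ltr01 lambda1).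
apply/eqP; rewrite -(@eqrXn2 _ m.+1)// ?(ltW (cavity_gt0 ler01))//.
by rewrite cavity_exprn// expr1n /c subrKC.
Qed.

Lemma cavity_det (x : R) : 0 < x -> cavity' x * (cavity x / x) ^+ m = 1.
Proof.
move=> x0; have B0 := cavity_base_gt0 (ltW x0).
rewrite /cavity' powRD ?(gt_eqF B0) ?implybT// powR_inv1 ?(ltW B0)// -/(cavity x).
rewrite expr_div_n.
have -> : x ^+ m * (cavity x / (x ^+ m.+1 + c)) * (cavity x ^+ m / x ^+ m) =
  (x ^+ m / x ^+ m) * (cavity x ^+ m.+1 / (x ^+ m.+1 + c)).
  by rewrite (exprS (cavity x)); move: (x ^+ m.+1 + c) => B; ring.
by rewrite cavity_exprn ?(ltW x0)// !divff ?mulr1// gt_eqF// exprn_gt0.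
Qed.

Lemma cavity'_gt0 (x : R) : 0 < x -> 0 < cavity' x.
Proof.
move=> x0; rewrite mulr_gt0 ?exprn_gt0// powR_gt0// cavity_base_gt0//.
exact: ltW.
Qed.

(** Term by term bound of the density at determinant 1, from [cavity' x <= 1], [x ^+ m <= 1] and
    [x ^+ m * ln v <= lambda]. *)
Definition cavity_bound : R :=
  kappa / m.+1%:R + h 1 + kappa * m%:R / m.+1%:R + kappa * m%:R * lambda.

Lemma cavity_density_bound (x : R) : 0 < x < 1 ->
  0 <= energy_density m kappa h cavity' cavity x <= cavity_bound.
Proof.
move=> /andP[x0 x1]; rewrite /energy_density /stored_energy cavity_det//.
set v := cavity x / x.
have v1 : 1 <= v by rewrite ler_pdivlMr// mul1r cavity_ge// ltW.
have ds0 := cavity'_gt0 x0.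
have ds1 : cavity' x <= 1.
  have vm : 1 <= v ^+ m by exact: exprn_ege1.
  by rewrite -(cavity_det x0) ler_peMr// ltW.
have ds1n : cavity' x ^+ m.+1 <= 1 by apply: exprn_ile1 => //; exact: ltW.
have ds0n : 0 <= cavity' x ^+ m.+1 by apply: exprn_ge0; exact: ltW.
have xm0 : 0 < x ^+ m by exact: exprn_gt0.
have xm1 : x ^+ m <= 1 by apply: exprn_ile1; exact: ltW.
have xmx : x ^+ m <= x.
  by case: m12 => ->; rewrite ?expr1// expr2 ler_piMr// ltW.
have ln0' : 0 <= ln v by exact: ln_ge0.
(* The logarithm is unbounded near 0, but [ln v <= v - 1] and [x * v = cavity x], which is at most
   [lambda]. *)
have lnl : x ^+ m * ln v <= lambda.
  apply: (@le_trans _ _ (x * ln v)); first exact: ler_wpM2r.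
  apply: le_trans (cavity_le (ltW x0) (ltW x1)).
  have -> : cavity x = x * v by rewrite /v mulrC divfK// gt_eqF.
  rewrite ler_pM2l//; have := le_ln1Dx (_ : -1 < v - 1).
  by rewrite subrKC => /(_ _) H; apply: (le_trans (H _)); lra.
rewrite natS_sub1 mulr1.
have n0 : 0 < m.+1%:R^-1 :> R by rewrite invr_gt0.
have m0 : 0 <= m%:R :> R by [].
have h10 : 0 <= h 1 by exact: h_ge0.
have km : 0 <= kappa * m%:R by rewrite mulr_ge0// ltW.
rewrite /cavity_bound; set w := m.+1%:R^-1 in n0 *.
set k := kappa * m%:R in km *.
have kw : 0 <= kappa * w by apply: mulr_ge0; exact: ltW.
have kw' : 0 <= k * w by apply: mulr_ge0 => //; exact: ltW.
apply/andP; split.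
  apply: mulr_ge0; first exact: ltW.
  apply: addr_ge0; first by apply: addr_ge0 => //; exact: mulr_ge0.
  by apply: mulr_ge0 => //; apply: addr_ge0 => //; exact: ltW.
have -> : x ^+ m * (kappa * w * cavity' x ^+ m.+1 + h 1 + k * (w + ln v)) =
  x ^+ m * (kappa * w * cavity' x ^+ m.+1) + x ^+ m * h 1 + x ^+ m * (k * w) +
  k * (x ^+ m * ln v) by ring.
have le1 a : 0 <= a -> x ^+ m * a <= a by move=> a0; rewrite ler_piMl.
apply: lerD; last exact: ler_wpM2l.
apply: lerD; last exact: le1.
apply: lerD; last exact: le1.
apply: le_trans (le1 _ _) _; first by rewrite mulr_ge0.
by rewrite ler_piMr.
Qed.

Lemma cavity_competitor :
  admissible lambda cavity /\
  (\int[mu]_(x in `]0%R, 1%R[) (Ihat_density m.+1 kappa h cavity x)%:E <=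
   cavity_bound%:E)%E.
Proof.
have cs : {within `[0, 1], continuous cavity}.
  exact: within_continuous_base_powR.
have cds : {within `[0, 1], continuous cavity'}.
  have cx : {within `[0, 1], continuous (fun x : R => x ^+ m)}.
    by apply: continuous_subspaceT => x; exact: exprn_continuous.
  have cp : {within `[0, 1], continuous
      (fun y : R => (y ^+ m.+1 + c) `^ (m.+1%:R^-1 - 1))}.
    exact: within_continuous_base_powR.
  by move=> x; apply: cvgM; [exact: cx|exact: cp].
have sD (x : R) : 0 < x < 1 -> is_derive x 1 cavity (cavity' x).
  by move=> /andP[/ltW x0 _]; exact: is_derive_cavity.
split.
  rewrite -{1}cavity_1; apply: (classical_admissible cs cds sD).
    by move=> x /andP[x0 _]; exact: cavity'_gt0.
  exact/ltW/cavity_gt0.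
rewrite (integral_density_ae (classical_weak_deriv cs cds sD)).
apply: (@le_trans _ _ (\int[mu]_(x in `]0%R, 1%R[) (cst cavity_bound%:E x))%E).
  apply: ge0_le_integral.
  - exact: measurable_itvR.
  - by move=> x; rewrite /= in_itv/= lee_fin => /cavity_density_bound/andP[].
  - apply/measurable_EFinP; apply: measurable_energy_density => //.
    + apply: (measurable_funS (measurable_itvR `[0, 1]%R)).
        exact: subset_itv_oo_cc.
      by apply: subspace_continuous_measurable_fun.
    + apply: (measurable_funS (measurable_itvR `[0, 1]%R)).
        exact: subset_itv_oo_cc.
      by apply: subspace_continuous_measurable_fun.
    + by move=> x /andP[x0 _]; exact: cavity'_gt0.
    + by move=> x /andP[/ltW x0 _]; exact: cavity_gt0.
  - exact: measurable_cst.
  - by move=> x; rewrite /= in_itv/= lee_fin => /cavity_density_bound/andP[].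
rewrite integral_cst; last exact: measurable_itvR.
rewrite [X in (_ * X)%E](_ : _ = 1%E) ?mule1//.
by apply: (etrans (lebesgue_measure_itv `]0, 1[%R)); rewrite /= lte_fin ltr01 sube0.
Qed.

End Cavity.

(* The energy of a deformation without cavity grows like
   [lambda ^+ m.+1 * ln lambda], that of [cavity] at most linearly. *)
Lemma cavity_bound_lt : exists2 Lambda : R, 1 < Lambda &
  forall lambda, Lambda < lambda ->
    cavity_bound lambda < min_energy m kappa h (lambda ^+ m.+1) / m.+1%:R.
Proof.
set C := kappa / m.+1%:R + h 1 + kappa * m%:R / m.+1%:R.
have n0 : 0 < m.+1%:R :> R by [].
have m1 : 1 <= m%:R :> R by rewrite ler1n; case: m12 => ->.
have h10 : 0 <= h 1 by exact: h_ge0.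
have C0 : 0 <= C / kappa.
  have k0 := ltW kappa0.
  apply: divr_ge0 => //; apply: addr_ge0; last first.
    by apply: divr_ge0 => //; exact: mulr_ge0.
  by apply: addr_ge0 => //; exact: divr_ge0.
(* The summand [C / kappa] gives [C < kappa * lambda], and the exponential gives
   [ln lambda >= 2 * m.+1%:R]. The factor 2 pays once for [C] and once for [kappa * m%:R * lambda],
   each at most [kappa * m%:R * d]. *)
exists (1 + C / kappa + expR (2 * m.+1%:R)).
  by have := expR_gt0 (2 * m.+1%:R : R); lra.
move=> lambda; set e := expR _ => Ll.
have e0 : 0 < e by exact: expR_gt0.
have l1 : 1 < lambda by lra.
have l0 : 0 < lambda by lra.
have Cl : C < kappa * lambda by rewrite -ltr_pdivrMl// mulrC; lra.
have lnl : 2 * m.+1%:R <= ln lambda.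
  by rewrite -[leLHS]expRK ler_ln ?posrE// -/e; lra.
have l2 : lambda ^+ 2 <= lambda ^+ m.+1.
  by rewrite ler_eXn2l//; case: m12 => ->.
have d0 : 0 < lambda ^+ m.+1 by exact: exprn_gt0.
have hd := h_ge0 d0.
rewrite ltr_pdivlMr// /min_energy lnXn// -[ln lambda *+ _]mulr_natl.
set d := lambda ^+ m.+1 in l2 d0 hd *.
have -> : kappa * d + h d +
    kappa * m%:R / m.+1%:R * (d * (m.+1%:R * ln lambda)) =
  kappa * d + h d + kappa * m%:R * (d * ln lambda) by field.
rewrite /cavity_bound -/C.
have kd : 0 < kappa * d by exact: mulr_gt0.
have H1 : d * (2 * m.+1%:R) <= d * ln lambda by rewrite ler_pM2l.
have km0 : 0 < kappa * m%:R by rewrite mulr_gt0//; lra.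
have H2 := ler_wpM2l (ltW km0) H1.
suff : (C + kappa * m%:R * lambda) * m.+1%:R <= kappa * m%:R * (d * (2 * m.+1%:R)).
  by lra.
have -> : kappa * m%:R * (d * (2 * m.+1%:R)) = (2 * (kappa * m%:R * d)) * m.+1%:R.
  by ring.
rewrite ler_pM2r//.
have ld : lambda <= d by apply: le_trans l2; rewrite expr2 ler_peMr//; lra.
have H3 : kappa * m%:R * lambda <= kappa * m%:R * d by rewrite ler_pM2l.
have H4 : kappa * lambda <= kappa * m%:R * lambda.
  by rewrite ler_pM2r// ler_peMr// ltW.
by lra.
Qed.

End Competitors.

(** * The critical stretch and the minimizers *)

Section Minimizers.
Context {R : realType}.
Notation mu := (@lebesgue_measure R).
Variables (m : nat) (kappa : R) (h : R -> R).
Hypothesis m12 : m = 1%N \/ m = 2%N.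
Hypothesis kappa0 : 0 < kappa.
Hypothesis h_ge0 : forall d : R, 0 < d -> 0 <= h d.
Hypothesis h_derivable : forall d : R, 0 < d -> derivable h d 1.
Hypothesis h_derivable2 : forall d : R, 0 < d -> derivable h^`()%classic d 1.
Hypothesis h_convex : forall d : R, 0 < d -> 0 < h^`(2)%classic d.
Hypothesis h'_at0 : h^`()%classic d @[d --> 0^'+] --> -oo.
Hypothesis h'_atoo : h^`()%classic d @[d --> +oo] --> +oo.

Lemma min_energy'_increasing (x y : R) : 0 < x -> x < y ->
  min_energy' m kappa h x < min_energy' m kappa h y.
Proof.
move=> x0 xy; have y0 := lt_trans x0 xy.
have H := h'_increasing h_derivable2 h_convex x0 xy.
have k0 : 0 <= kappa * m%:R / m.+1%:R.
  by rewrite divr_ge0// mulr_ge0// ltW.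
have L : ln x < ln y by rewrite ltr_ln.
rewrite /min_energy'; set k := kappa * m%:R / m.+1%:R in k0 *.
by nra.
Qed.

Lemma min_energy'_root : exists2 d : R, 0 < d & min_energy' m kappa h d = 0.
Proof.
set k := kappa * m%:R / m.+1%:R.
have k0 : 0 <= k by rewrite divr_ge0// mulr_ge0// ltW.
(* The threshold cancels the constant part [kappa + k] of [min_energy']; to the left of 1 the
   logarithm only helps the negative sign. *)
have [a [a0 a1 ha]] : exists a : R,
    [/\ 0 < a, a < 1 & h^`()%classic a < - (kappa + k)].
  near (0 : R)^'+ => a; exists a; split.
  - by near: a; exact: nbhs_right_gt.
  - by near: a; exact: nbhs_right_lt.
  - by near: a; move/cvgrNyPlt : h'_at0; exact.
have [b [b1 hb]] : exists b : R, 1 < b /\ 0 < h^`()%classic b.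
  near +oo_R => b; exists b; split.
  - by near: b; exact: nbhs_pinfty_gt.
  - by near: b; move/cvgryPgt : h'_atoo; exact.
have ab : a <= b by lra.
have b0 : 0 < b by lra.
have ln_a : ln a <= 0 by rewrite ln_le0// ltW.
have ln_b : 0 <= ln b by rewrite ln_ge0// ltW.
have kln_a : k * ln a <= 0 by exact: mulr_ge0_le0.
have kappa0' := kappa0.
have kln_b : 0 <= k * ln b by exact: mulr_ge0.
have ma : min_energy' m kappa h a < 0.
  by rewrite /min_energy' -/k mulrDr mulr1; clearbody k; lra.
have mb : 0 < min_energy' m kappa h b.
  by rewrite /min_energy' -/k mulrDr mulr1; clearbody k; lra.
have cm : {within `[a, b], continuous (min_energy' m kappa h)}.
  apply: within_continuous_pos => // d d0.
  have ch : {for d, continuous h^`()%classic}.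
    apply: differentiable_continuous; apply/derivable1_diffP.
    exact: h_derivable2.
  apply: cvgD; first by apply: cvgD; [exact: cvg_cst|exact: ch].
  apply: cvgM; first exact: cvg_cst.
  by apply: cvgD; [exact: continuous_ln|exact: cvg_cst].
have v0 : Num.min (min_energy' m kappa h a) (min_energy' m kappa h b) <= 0 <=
    Num.max (min_energy' m kappa h a) (min_energy' m kappa h b).
  by rewrite ge_min le_max (ltW ma) (ltW mb) orbT.
have [d] := IVT ab cm v0; rewrite in_itv/= => /andP[ad _] md.
by exists d => //; exact: lt_le_trans ad.
Unshelve. all: by end_near. Qed.

Lemma That_diag_root : exists v : R,
  unique (fun v => 0 < v /\ That m.+1 kappa h v v = 0) v.
Proof.
have [d d0 md] := min_energy'_root.
exists (d `^ m.+1%:R^-1).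
have vn : (d `^ m.+1%:R^-1) ^+ m.+1 = d.
  by rewrite -powR_mulrn ?powR_ge0// -powRrM mulVf// powRr1// ltW.
have v0 : 0 < d `^ m.+1%:R^-1 by exact: powR_gt0.
split; first by split => //; rewrite That_diag// vn.
move=> v [vp]; rewrite That_diag// => mv.
apply/eqP; rewrite -(@eqrXn2 _ m.+1)// ?ltW// vn.
have vnp : 0 < v ^+ m.+1 by exact: exprn_gt0.
have [dv|dv|//] := ltgtP d (v ^+ m.+1).
  by have := min_energy'_increasing d0 dv; rewrite md mv ltxx.
by have := min_energy'_increasing vnp dv; rewrite md mv ltxx.
Qed.

(** The term subtracted in [Ihat] is finite and depends only on [lambda], so it cancels between
    competitors even if an integral is infinite. *)
Lemma minimizer_integral_le (lambda : R) (r s : R -> R) (B : R) :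
  Ihat_minimizer m.+1 kappa h lambda r -> admissible lambda s ->
  (\int[mu]_(x in `]0%R, 1%R[) (Ihat_density m.+1 kappa h s x)%:E <= B%:E)%E ->
  (\int[mu]_(x in `]0%R, 1%R[) (Ihat_density m.+1 kappa h r x)%:E <= B%:E)%E.
Proof.
move=> [_ /(_ s) rs] sA sB; apply: le_trans sB.
by have := rs sA; rewrite /Ihat leeD2rE.
Qed.

Lemma minimizer_linear (lambda : R) (r : R -> R) : 0 < lambda ->
  min_energy' m kappa h (lambda ^+ m.+1) < 0 ->
  Ihat_minimizer m.+1 kappa h lambda r ->
  forall x, 0 <= x <= 1 -> r x = lambda * x.
Proof.
move=> l0 ml rmin; have [rA _] := rmin.
have [sA /eqP] := linear_competitor kappa h m12 l0.
rewrite eq_le => /andP[sE _].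
have := minimizer_integral_le rmin sA sE.
have [gam [gami gam0 gamE rgam]] := admissible_representative rA.
have [[cr _ _] r1 _ r0] := rA.
rewrite (integral_density_ae m kappa h gamE) => I_le.
(* Finiteness comes from the competitor. It matters because the real-valued integral is [fine] of
   the extended one, which sends [+oo] to 0. *)
have Ilty := le_lt_trans I_le (ltry _).
have ei := integrable_energy_density kappa0 h_derivable h_derivable2
  h_convex r1 cr gami gam0 rgam r0 Ilty.
apply: (energy_density_rigid m12 kappa0 h_derivable h_derivable2
  h_convex r1 cr gami gam0 rgam r0 Ilty) => //.
have IE := fineK (integrable_fin_num (measurable_itvR `]0, 1[%R) ei).
by rewrite -lee_fin; apply: le_trans I_le; rewrite -[leRHS]IE.
Qed.

Lemma minimizer_cavitates : exists2 Lambda : R, 0 < Lambda &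
  forall lambda, Lambda < lambda -> forall r : R -> R,
  Ihat_minimizer m.+1 kappa h lambda r -> 0 < r 0.
Proof.
have [Lambda L1 HL] := cavity_bound_lt m12 kappa0 h_ge0.
exists Lambda; first by lra.
move=> lambda Ll r rmin; have [rA _] := rmin.
have l1 : 1 < lambda by lra.
have [sA sE] := cavity_competitor m12 kappa0 h_ge0 h_derivable l1.
have := minimizer_integral_le rmin sA sE.
have [gam [gami gam0 gamE rgam]] := admissible_representative rA.
have [[cr _ _] r1 _ r0] := rA.
rewrite (integral_density_ae m kappa h gamE) => I_le.
have Ilty := le_lt_trans I_le (ltry _).
have ei := integrable_energy_density kappa0 h_derivable h_derivable2
  h_convex r1 cr gami gam0 rgam r0 Ilty.
rewrite lt_def r0 andbT; apply/eqP => r00.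
have := energy_density_lower m12 kappa0 h_derivable h_derivable2
  h_convex r1 cr gami gam0 rgam r0 Ilty r00.
apply/negP; rewrite -ltNge; apply: le_lt_trans (HL _ Ll).
have IE := fineK (integrable_fin_num (measurable_itvR `]0, 1[%R) ei).
by rewrite -lee_fin; apply: le_trans I_le; rewrite -[leRHS]IE.
Qed.

End Minimizers.

Unset Implicit Arguments.
Set Strict Implicit.

Theorem proposition3p5 (R : realType) (n : nat) (kappa : R) (h : R -> R)
  (hn : n = 2%N \/ n = 3%N)
  (kappa_gt0 : 0 < kappa)
  (h_ge0 : forall d : R, 0 < d -> 0 <= h d)
  (h_derivable : forall d : R, 0 < d -> derivable h d 1)
  (h_C1 : forall d : R, 0 < d -> {for d, continuous h^`()%classic})
  (h_derivable2 : forall d : R, 0 < d -> derivable h^`()%classic d 1)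
  (h_convex : forall d : R, 0 < d -> 0 < h^`(2)%classic d)
  (h_at0 : h d @[d --> 0^'+] --> +oo)
  (h_atoo : h d / d @[d --> +oo] --> +oo)
  (h'_at0 : h^`()%classic d @[d --> 0^'+] --> -oo)
  (h'_atoo : h^`()%classic d @[d --> +oo] --> +oo)
  (h_growth : exists K gamma0 : R, [/\ 0 < K, 0 < gamma0 &
     forall d c : R, 0 < d -> `|c - 1| <= gamma0 ->
       `|d * h^`()%classic (c * d)| <= K * (h d + 1)]) :
  (exists lambdabar : R,
     unique (fun v : R => 0 < v /\ That n kappa h v v = 0) lambdabar /\
     forall lambda : R, 0 < lambda -> lambda < lambdabar ->
       forall r : R -> R, Ihat_minimizer n kappa h lambda r ->
         forall x : R, 0 <= x <= 1 -> r x = lambda * x) /\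
  (exists2 Lambda : R, 0 < Lambda &
     forall lambda : R, Lambda < lambda ->
       forall r : R -> R, Ihat_minimizer n kappa h lambda r -> 0 < r 0).
Proof.
have [m nE m12] : exists2 m, n = m.+1 & m = 1%N \/ m = 2%N.
  by case: hn => ->; [exists 1%N => //; left|exists 2%N => //; right].
subst n; split; last exact: minimizer_cavitates.
have [v vP] := That_diag_root m kappa_gt0 h_derivable2 h_convex h'_at0 h'_atoo.
exists v; split => // lambda l0 lv r.
apply: minimizer_linear => //.
have [[v0 Tv] _] := vP.
(* Reading 0 as [min_energy'] at [v ^+ m.+1] turns the sign condition at [lambda ^+ m.+1] into
   strict monotonicity. *)
rewrite That_diag// in Tv; rewrite -Tv; apply: min_energy'_increasing => //.
  exact: exprn_gt0.
by rewrite ltrXn2r// ltW.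
Qed.
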